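(* Let $n\ge1$ and let $T$ be a good tree on the vertex set $[n+1]$. Let $c(n,l)$ be the number of noncrossing alternating spanning trees $T_m$ of $\overline{T}$ with $|S_T(T_m)|=l$. Then $$(1-x)^{n+1}J(\mathcal{P}(T),x)=\sum_{l=1}^n c(n,l-1)\,x^{l-1}.$$
   Context: Graphs have vertex set $[n+1]=\{1,\ldots,n+1\}$; an edge joining $i<j$ is written $(i,j)$, and $(i,j)_a$ is the edge $(i,j)$ with label $a$. A graph is noncrossing if there are no $i<j<k<l$ with $(i,k),(j,l)$ both edges; alternating if there are no $i<j<k$ with $(i,j),(j,k)$ both edges. The transitive closure $\overline{G}$ has as edges all $(i,j)$ for which there are edges $(i,i_1),(i_1,i_2),\ldots,(i_r,j)$ of $G$ with $i<i_1<\cdots<i_r<j$ (edges of $G$ included). A spanning tree of $\overline{T}$ is a tree with vertex set $[n+1]$ with all edges in $\overline{T}$. A forest $H$ on $[n+1]$ with $k$ edges labeled $1,\ldots,k$ is good if: (i) if $(i,j)_a,(j,k)_b$ are edges, $i<j<k$, then $a<b$; (ii) if $(i,j)_a,(i,k)_b$ are edges with $i<j<k$, then $a>b$; (iii) if $(i,j)_a,(k,j)_b$ are edges with $i<k<j$, then $a>b$; (iv) $H$ is noncrossing. A good tree is a good forest that is a tree. Let $e_1,\ldots,e_{n+1}$ be the coordinate vectors of $\mathbb{R}^{n+1}$. $\mathcal{P}(A_n^+)$ is the convex hull of the origin and the points $e_i-e_j$, $1\le i<j\le n+1$; $\mathcal{C}(G)$ is the cone of nonnegative combinations of the $e_i-e_j$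 with $(i,j)\in E(G)$, $i<j$; and $\mathcal{P}(G)=\mathcal{P}(A_n^+)\cap\mathcal{C}(G)$. The Ehrhart polynomial of an integer polytope $\mathcal{P}\subset\mathbb{R}^{n+1}$ is $L_{\mathcal{P}}(t)=\#(t\mathcal{P}\cap\mathbb{Z}^{n+1})$, and $J(\mathcal{P},x)=1+\sum_{t=1}^\infty L_{\mathcal{P}}(t)x^t$. Let $T_m$ be a noncrossing alternating spanning tree of $\overline{T}$. $L(T_m)$ is the set of left vertices of $T_m$: the vertices which are the smaller vertex of each edge of $T_m$ incident to them. $S(T_m)=\{(i,j)\mid i\in L(T_m)$ and $j$ is the largest vertex adjacent to $i$ in $T_m\}$. For $(i,j)\in S(T_m)\setminus\{(1,n+1)\}$ define $f_{T_m}((i,j))=(i',j')$, where $i'$ is the biggest vertex of $T_m$ smaller than $i$ such that $(i',j)\in E(T_m)$, and $j'$ is the biggest vertex of $T_m$ smaller than $j$ such that $(i,j')\in E(T_m)$, or $j'=i$ if $(i,j)$ is the only edge of $T_m$ incident to $i$. Finally, $S_T(T_m)=\{(i,j)\in S(T_m)\setminus\{(1,n+1)\}\mid f_{T_m}((i,j))\in E(\overline{T})\}$. *)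

(* Defs.v *)
From mathcomp Require Import all_boot all_order all_algebra.
From mathcomp Require Import finmap.
From mathcomp Require Import all_classical reals.

Set Implicit Arguments.
Unset Strict Implicit.
Unset Printing Implicit Defensive.

Import Order.TTheory GRing.Theory Num.Theory.

Local Open Scope ring_scope.

Section Graphs.

Variable n : nat.

(* The vertex set {1, ..., n+1} is represented by {0, ..., n}, in the same
   order: 1 is ord0 and n+1 is ord_max. An edge joining i < j is the pair
   (i, j), and a graph is the set of its edges. *)
Notation V := 'I_n.+1.
Notation graph := {set V * V}.

Implicit Types (G T M : graph) (lab : V * V -> nat).

Definition is_graph G : bool := [forall e in G, (e.1 < e.2)%N].

Definition adj G : rel V := fun i j => ((i, j) \in G) || ((j, i) \in G).

Definition connected_graph G : Prop := forall i j : V, connect (adj G) i j.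

(* [ucycle (adj G) s] also holds when s is a single edge travelled back and
   forth, hence the bound on [size s]. *)
Definition acyclic G : Prop :=
  forall s : seq V, (2 < size s)%N -> ~ ucycle (adj G) s.

Definition is_forest G : Prop := is_graph G /\ acyclic G.

Definition is_tree G : Prop := is_forest G /\ connected_graph G.

Definition noncrossing G : Prop :=
  forall i j k l : V, (i < j)%N -> (j < k)%N -> (k < l)%N ->
    ~ ((i, k) \in G /\ (j, l) \in G).

Definition alternating G : Prop :=
  forall i j k : V, (i < j)%N -> (j < k)%N ->
    ~ ((i, j) \in G /\ (j, k) \in G).

(* (i, j) is in the closure when i < i_1 < ... < i_r < j for some
   s = [:: i_1; ...; i_r], possibly empty, with consecutive vertices joined by
   edges of G. *)
Definition transitive_closure G : graph :=
  [set e : V * V | `[< exists s : seq V,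
     path (fun i j : V => (i < j)%N && ((i, j) \in G)) e.1
          (rcons s e.2) >]]%SET.

Definition spanning_tree_of M G : Prop := is_tree M /\ M \subset G.

(* The edges of G carry the labels 1, ..., #|G|, each used once. *)
Definition edge_labeling G lab : Prop :=
  {in G &, injective lab} /\ {in G, forall e, 1 <= lab e <= #|G|}%N.

Definition good_labeling G lab : Prop :=
  [/\ forall i j k : V, (i < j)%N -> (j < k)%N ->
        (i, j) \in G -> (j, k) \in G -> (lab (i, j) < lab (j, k))%N,
      forall i j k : V, (i < j)%N -> (j < k)%N ->
        (i, j) \in G -> (i, k) \in G -> (lab (i, j) > lab (i, k))%N
    & forall i j k : V, (i < k)%N -> (k < j)%N ->
        (i, j) \in G -> (k, j) \in G -> (lab (i, j) > lab (k, j))%N].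

Definition good_forest G lab : Prop :=
  [/\ is_forest G, edge_labeling G lab, good_labeling G lab & noncrossing G].

Definition good_tree G lab : Prop := good_forest G lab /\ is_tree G.

Definition incident (i : V) (e : V * V) : bool := (e.1 == i) || (e.2 == i).

Definition left_vertices M : {set V} :=
  [set i : V | [forall e in M, incident i e ==> (e.1 == i)]]%SET.

Definition is_biggest (P : pred V) (i : V) : bool :=
  P i && [forall k : V, P k ==> (k <= i)%N].

Definition S_set M : graph :=
  [set e : V * V | (e.1 \in left_vertices M)
                   && is_biggest (adj M e.1) e.2]%SET.

Definition biggest (P : pred V) (default : V) : V :=
  odflt default [pick i | is_biggest P i].

(* For e in [S_set M] other than (ord0, ord_max), with M a noncrossing
   alternating tree, the biggest vertices below exist, so the defaults of
   [biggest] are not used. *)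
Definition f_map M (e : V * V) : V * V :=
  let: (i, j) := e in
  (biggest (fun i' : V => (i' < i)%N && ((i', j) \in M)) i,
   if [forall e' in M, incident i e' ==> (e' == e)] then i
   else biggest (fun j' : V => (j' < j)%N && ((i, j') \in M)) i).

Definition S_T T M : graph :=
  [set e in S_set M :\ (ord0, ord_max)
     | f_map M e \in transitive_closure T]%SET.

(* The number c(n, l), which depends on T. *)
Definition c_count T (l : nat) : nat :=
  #|[set M : graph | `[< [/\ noncrossing M, alternating M,
        spanning_tree_of M (transitive_closure T)
      & #|S_T T M| = l] >]]%SET|.

End Graphs.

Section Polytopes.

Variable R : realType.

Definition convex_hull (U : lmodType R) (A : set U) : set U :=
  [set v | exists (k : nat) (a : 'I_k -> R) (x : 'I_k -> U),
     [/\ forall s, 0 <= a s, \sum_(s < k) a s = 1, forall s, A (x s)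
       & v = \sum_(s < k) a s *: x s]]%classic.

Variable n : nat.

Notation V := 'I_n.+1.

(* e_i - e_j for p = (i, j) *)
Definition root_vector (p : V * V) : 'rV[R]_n.+1 :=
  delta_mx 0 p.1 - delta_mx 0 p.2.

Definition full_root_polytope : set 'rV[R]_n.+1 :=
  convex_hull
    ([set 0] `|`
     [set root_vector p | p in [set p : V * V | (p.1 < p.2)%N]])%classic.

Definition root_cone (G : {set V * V}) : set 'rV[R]_n.+1 :=
  [set v | exists2 a : V * V -> R, {in G, forall p, 0 <= a p}
         & v = \sum_(p in G) a p *: root_vector p]%classic.

Definition root_polytope (G : {set V * V}) : set 'rV[R]_n.+1 :=
  (full_root_polytope `&` root_cone G)%classic.

End Polytopes.

Arguments full_root_polytope : clear implicits.
Arguments root_cone R {n} G.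
Arguments root_polytope R {n} G.

Section Ehrhart.

Variables (R : realType) (m : nat).

Definition dilate (t : nat) (P : set 'rV[R]_m) : set 'rV[R]_m :=
  [set t%:R *: v | v in P]%classic.

(* Junk value 0 if P is unbounded with infinitely many lattice points, which
   does not concern polytopes. *)
Definition ehrhart (P : set 'rV[R]_m) (t : nat) : nat :=
  #|` fset_set [set z : 'rV[int]_m | dilate t P (map_mx intr z)]%classic |%fset.

End Ehrhart.

(* Formal power series with integer coefficients, as coefficient sequences. *)
Definition fps := nat -> int.

Definition fps_of_poly (p : {poly int}) : fps := fun k => p`_k.

Definition fps_mul (f g : fps) : fps :=
  fun k => \sum_(i < k.+1) f i * g (k - i)%N.

Definition ehrhart_series (R : realType) (m : nat) (P : set 'rV[R]_m) : fps :=
  fun t => if t == 0%N then 1 else (ehrhart P t)%:R.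

(* Main.v *)
(* Cutting by height, (1-x) J(P(T), x) is the generating function, by the sum of the
   positive coordinates, of the integer points z of the cone C(T). As T is a tree, such a
   z is a nonnegative integer combination of edges of T; replacing repeatedly (i,j),(j,k)
   by (i,k) and crossing edges (i,k),(j,l) by (i,l),(j,k), which stay in the closure
   because T is noncrossing, turns it into a combination supported on a noncrossing
   alternating subgraph of the closure (a face), and this form of z is unique. Hence
   L(t) is the sum of C(t,|F|) over the faces F.
   Every face F lies in exactly one interval S_T(M) <= F <= M with M a noncrossing
   alternating spanning tree of the closure. Summing over the interval of M gives
   C(t + n - |S_T(M)|, n) by Pascal's rule, whose generating series is
   x^|S_T(M)| / (1-x)^(n+1). *)
Require Import Defs.
From mathcomp Require Import all_boot all_order all_algebra finmap zify.
From mathcomp Require Import all_classical reals.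

Set Implicit Arguments.
Unset Strict Implicit.
Unset Printing Implicit Defensive.

Import Order.TTheory GRing.Theory Num.Theory.

(** The map f is a tree rotation. When the noncrossing alternating spanning trees are read as binary
    trees, an edge e of S other than (1,n+1) is the root of a right subtree, and exchanging e for
    f(e) turns [Node l (Node rl rr)] into [Node (Node l rl) rr]. So S_T(M) consists of the edges
    whose rotation stays inside the closure, and F lies in the interval of M when M contains F and
    every rotation available in the closure would remove an edge of F. M is then a local optimum for
    large left subtrees; that a local optimum above F exists and is the only one is the heart of the
    proof. It rests on planarity: two increasing paths with interleaved ends share a vertex. Height
    is the right parameter because a sum of coordinates is at most 1 on the full root polytope,
    while for a combination of alternating edges nothing cancels and the sum of the positive
    coordinates is the total multiplicity. *)

Lemma ex_maxP (P : nat -> Prop) N : (exists k, P k) -> (forall k, P k -> k <= N) ->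
  exists2 k, P k & forall j, P j -> j <= k.
Proof.
move=> [k0 Pk0] leN.
have exb : exists k, `[< P k >] by exists k0; apply/asboolP.
have leb k : `[< P k >] -> k <= N by move/asboolP/leN.
case: (ex_maxnP exb leb) => k /asboolP Pk maxk; exists k => // j Pj.
by apply: maxk; apply/asboolP.
Qed.

Lemma ex_minP (P : nat -> Prop) : (exists k, P k) ->
  exists2 k, P k & forall j, P j -> k <= j.
Proof.
move=> [k0 Pk0]; have exb : exists k, `[< P k >] by exists k0; apply/asboolP.
case: (ex_minnP exb) => k /asboolP Pk mink; exists k => // j Pj.
by apply: mink; apply/asboolP.
Qed.

(** * Increasing paths in a noncrossing connected graph *)

(** Vertices are plain natural numbers here, so that intervals can be cut and shifted freely and
    [lia] applies. *)
Inductive reach (E : nat -> nat -> Prop) : nat -> nat -> Prop :=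
| reach_refl x : reach E x x
| reach_step x y z : E x y -> reach E y z -> reach E x z.

Lemma reach1 E x y : E x y -> reach E x y.
Proof. by move=> Exy; apply: reach_step Exy (reach_refl _ _). Qed.

Lemma reach_trans E x y z : reach E x y -> reach E y z -> reach E x z.
Proof. by move=> Rxy Ryz; elim: Rxy Ryz => // a b c Eab _ IH /IH; apply: reach_step. Qed.

Section NoncrossingReach.

Variables (n : nat) (E : nat -> nat -> Prop).
Hypothesis E_lt : forall x y, E x y -> x < y.
Hypothesis E_nc : forall i j k l, i < j -> j < k -> k < l -> E i k -> E j l -> False.
(** Connectedness as seen by intervals: an edge leaves every proper subinterval of [[0, n]], to the
    right or to the left. *)
Hypothesis E_exit : forall c v, c <= v -> v <= n -> (0 < c) || (v < n) ->
  exists x y, E x y /\ ((c <= x <= v) && (v < y <= n) || (x < c) && (c <= y <= v)).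

Notation R := (reach E).

Lemma reach_le x y : R x y -> x <= y.
Proof. by elim=> // a b c /E_lt lt_ab _; apply: leq_trans; apply: ltnW. Qed.

Lemma reach_last x y : R x y -> x < y -> exists2 u, R x u & E u y.
Proof.
elim=> [z|a b c Eab Rbc IH _]; first by rewrite ltnn.
have := reach_le Rbc; rewrite leq_eqVlt => /orP[/eqP eq_bc|/IH[u Rbu Euc]].
  by exists a; [exact: reach_refl | rewrite -eq_bc].
by exists u => //; apply: reach_step Eab Rbu.
Qed.

(** The path starts under the edge from [a] to [d] and ends at or past [d]; a step jumping over [d]
    would cross that edge. *)
Lemma reach_under_edge a d c b : E a d -> a < c -> c <= d -> d <= b -> R c b ->
  R c d /\ R d b.
Proof.
move=> Ead + + + Rcb; elim: Rcb => [x|x y z Exy Ryz IH] lt_ax le_xd le_dz.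
  by have -> : d = x by [lia]; split; apply: reach_refl.
have [eq_xd|ne_xd] := eqVneq x d.
  by rewrite -eq_xd; split; [exact: reach_refl | exact: reach_step Exy Ryz].
have lt_xy := E_lt Exy.
have le_yd : y <= d.
  by rewrite leqNgt; apply/negP => lt_dy; apply: (E_nc _ _ _ Ead Exy); lia.
have [|||Ryd Rdz] := IH; try lia.
by split=> //; apply: reach_step Exy Ryd.
Qed.

(** Planarity of increasing paths. Follow the first path until it hits [c] or has an edge passing
    over [c]; in the latter case the second path starts under this edge and must go through its far
    end. *)
Lemma reach_meet a k c b : R a k -> R c b -> a <= c -> c <= k -> k <= b ->
  exists s, [/\ R a s, R s k, R c s & R s b].
Proof.
move=> Rak; elim: Rak c b => [x|x y z Exy Ryz IH] c b Rcb le_xc le_cz le_zb.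
  have eq_xc : x = c by lia.
  by exists x; rewrite -eq_xc in Rcb *; split=> //; apply: reach_refl.
have [eq_xc|ne_xc] := eqVneq x c.
  exists x; rewrite -eq_xc in Rcb *; split=> //; try exact: reach_refl.
  exact: reach_step Exy Ryz.
have [le_yc|lt_cy] := leqP y c.
  have [s [Rys Rsz Rcs Rsb]] := IH c b Rcb le_yc le_cz le_zb.
  by exists s; split=> //; apply: reach_step Exy Rys.
have le_yz := reach_le Ryz.
have [|||Rcy Ryb] := reach_under_edge Exy _ _ _ Rcb; try lia.
by exists y; split=> //; apply: reach1.
Qed.

Lemma reach_meet_left a k c b : R a k -> R c b -> a <= c -> c <= k -> k <= b -> R a b.
Proof.
move=> Rak Rcb h1 h2 h3; have [s [Ras _ _ Rsb]] := reach_meet Rak Rcb h1 h2 h3.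
exact: reach_trans Ras Rsb.
Qed.

Lemma reach_meet_right a k c b : R a k -> R c b -> a <= c -> c <= k -> k <= b -> R c k.
Proof.
move=> Rak Rcb h1 h2 h3; have [s [_ Rsk Rcs _]] := reach_meet Rak Rcb h1 h2 h3.
exact: reach_trans Rcs Rsk.
Qed.

(** If the last vertex [v] reached from 0 were not [n], an edge leaving [[0, v]] would meet the path
    from 0 to [v], and its far end would be reached too. *)
Lemma reach_full : R 0 n.
Proof.
have [||v [Rv le_vn] max_v] := @ex_maxP (fun v => R 0 v /\ v <= n) n.
- by exists 0; split=> //; apply: reach_refl.
- by move=> k [].
have [<- //|ne_vn] := eqVneq v n.
have [|||x [y [Exy xy_exit]]] := @E_exit 0 v; try lia.
suff /max_v : R 0 y /\ y <= n by lia.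
split; last by lia.
by apply: (reach_meet_left Rv (reach1 Exy)); lia.
Qed.

(** Let [v] be the last vertex up to [w] reached from [k.+1], and suppose that [v] is not [w]. An
    edge leaving [[k.+1, v]] to the right cannot jump over [w], because the last edge [(p, w)] of a
    path from [a] has [p <= k]; it would then extend the reach of [k.+1]. An edge entering from the
    left meets the path from [a] to [k], so [a] would reach a vertex strictly between [k] and
    [w]. *)
Lemma reach_max_pred a w k : R a w -> a <= k < w -> w <= n -> R a k ->
  (forall k', R a k' -> k' < w -> k' <= k) -> R k.+1 w.
Proof.
move=> Raw /andP[le_ak lt_kw] le_wn Rak max_k.
have [p Rap Epw] := reach_last Raw (leq_ltn_trans le_ak lt_kw).
have lt_pw := E_lt Epw; have le_pk : p <= k by exact: max_k.
have le_ap := reach_le Rap.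
have [||v [Rv le_vw] max_v] := @ex_maxP (fun v => R k.+1 v /\ v <= w) w.
- by exists k.+1; split=> //; apply: reach_refl.
- by move=> ? [].
have [<- //|ne_vw] := eqVneq v w.
have le_kv := reach_le Rv.
have [|||x [y [Exy xy_exit]]] := @E_exit k.+1 v; try lia.
have lt_xy := E_lt Exy.
have le_yw : y <= w.
  rewrite leqNgt; apply/negP => lt_wy.
  by apply: (E_nc _ _ _ Epw Exy); lia.
have [/andP[/andP[le_kx le_xv] lt_vy]|] := orP xy_exit.
  suff /max_v : R k.+1 y /\ y <= w by lia.
  by split=> //; apply: (reach_meet_left Rv (reach1 Exy)); lia.
move=> /andP[lt_xk /andP[le_ky le_yv]].
have le_px : p <= x.
  rewrite leqNgt; apply/negP => lt_xp.
  by apply: (E_nc _ _ _ Exy Epw); lia.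
suff /max_k : R a y by lia.
by apply: (reach_meet_left Rak (reach1 Exy)); lia.
Qed.

(** Take [w], the first vertex beyond [j] on some path from [a] to [b], and [k], the last vertex
    before [w] reached from [a]. A connection over the gap that starts at some [x > j] would also
    lead from [x] to [w], hence meet a path from [a] to [k] in a vertex lying between [j] and [w]
    and on a path from [a] to [b], against the choice of [w]. *)
Lemma reach_gap a j b : R a b -> a <= j < b -> b <= n -> R a j ->
  exists k, [/\ j <= k < b, R a k, R k.+1 b &
    forall x y, a <= x -> x <= k -> k < y -> y <= b -> R x y -> x <= j].
Proof.
move=> Rab /andP[le_aj lt_jb] le_bn Raj.
have [|w [Raw Rwb lt_jw] min_w] := @ex_minP (fun w => [/\ R a w, R w b & j < w]).
  by exists b; split=> //; apply: reach_refl.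
have [||k [Rak lt_kw] max_k] := @ex_maxP (fun k => R a k /\ k < w) w.
- by exists j.
- by move=> k []; lia.
have le_jk : j <= k by exact: max_k.
have le_wb := reach_le Rwb.
have Rkw : R k.+1 w.
  apply: (reach_max_pred Raw _ _ Rak); try lia.
  by move=> k' Rak' lt_k'w; apply: max_k.
exists k; split=> //; first by lia.
  exact: reach_trans Rkw Rwb.
move=> x y le_ax le_xk lt_ky le_yb Rxy; rewrite leqNgt; apply/negP => lt_jx.
have Ray : R a y by apply: (reach_meet_left Rak Rxy); lia.
have le_wy : w <= y.
  by rewrite leqNgt; apply/negP => lt_yw; have := max_k y (conj Ray lt_yw); lia.
have Rxw : R x w by apply: (reach_meet_right Raw Rxy); lia.
have [|||s [Ras Rsk Rxs Rsw]] := reach_meet Rak Rxw; try lia.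
have := reach_le Rxs; have := reach_le Rsk.
suff /min_w : [/\ R a s, R s b & j < s] by lia.
split=> //; first exact: reach_trans Rsw Rwb.
by have := reach_le Rxs; lia.
Qed.

End NoncrossingReach.

(** * Noncrossing alternating trees *)

Inductive bt := Leaf | Node (l r : bt).

Fixpoint bt_size t := if t is Node l r then (bt_size l + bt_size r).+1 else 0.

(* The full binary tree t with [bt_size t] internal nodes encodes a noncrossing
   alternating tree on the interval [a, a + bt_size t]: the root is the longest
   edge, and the two subtrees are the components left after deleting it. *)
Fixpoint edges a t : seq (nat * nat) :=
  if t is Node l r then
    (a, a + bt_size t) :: edges a l ++ edges (a + bt_size l).+1 r
  else [::].

(* The pairs (e, f(e)), for e ranging over the elements of S other than the root. *)
Fixpoint flips a t : seq ((nat * nat) * (nat * nat)) :=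
  if t is Node l r then
    (if r is Node rl _ then
       [:: (((a + bt_size l).+1, a + bt_size t),
            (a, (a + bt_size l).+1 + bt_size rl))]
     else [::]) ++ flips a l ++ flips (a + bt_size l).+1 r
  else [::].

Lemma edges_bound a t x y : (x, y) \in edges a t ->
  [/\ a <= x, x < y & y <= a + bt_size t].
Proof.
elim: t a => //= l IHl r IHr a; rewrite inE mem_cat => /or3P[|/IHl|/IHr].
- by rewrite xpair_eqE => /andP[/eqP-> /eqP->]; split; lia.
- by case; split; lia.
- by case; split; lia.
Qed.

Lemma size_edges a t : size (edges a t) = bt_size t.
Proof. by elim: t a => //= l IHl r IHr a; rewrite size_cat IHl IHr. Qed.

Lemma uniq_edges a t : uniq (edges a t).
Proof.
elim: t a => //= l IHl r IHr a; rewrite mem_cat negb_or cat_uniq IHl IHr !andbT /=.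
apply/andP; split; first (apply/andP; split).
- by apply/negP => /edges_bound[]; lia.
- by apply/negP => /edges_bound[]; lia.
by apply/hasPn => -[x y] /edges_bound[? ? ?]; apply/negP => /edges_bound[]; lia.
Qed.

Lemma edges_nc a t i j k l : i < j -> j < k -> k < l ->
  (i, k) \in edges a t -> (j, l) \in edges a t -> False.
Proof.
move=> lt_ij lt_jk lt_kl; elim: t a => //= tl IHl tr IHr a.
rewrite !inE !mem_cat !xpair_eqE.
case/or3P=> [/andP[/eqP ei /eqP ek]|Hik|Hik];
  case/or3P=> [/andP[/eqP ej /eqP el]|Hjl|Hjl];
  try (by apply: IHl Hik Hjl); try (by apply: IHr Hik Hjl);
  try (case: (edges_bound Hik) => ? ? ?); try (case: (edges_bound Hjl) => ? ? ?); lia.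
Qed.

Lemma edges_alt a t i j k : (i, j) \in edges a t -> (j, k) \in edges a t -> False.
Proof.
elim: t a => //= tl IHl tr IHr a.
rewrite !inE !mem_cat !xpair_eqE.
case/or3P=> [/andP[/eqP ei /eqP ek]|Hik|Hik];
  case/or3P=> [/andP[/eqP ej /eqP el]|Hjl|Hjl];
  try (by apply: IHl Hik Hjl); try (by apply: IHr Hik Hjl);
  try (case: (edges_bound Hik) => ? ? ?); try (case: (edges_bound Hjl) => ? ? ?); lia.
Qed.

Lemma edges_connected a t (P : nat -> Prop) x y :
  (forall u v, (u, v) \in edges a t -> P u <-> P v) ->
  a <= x <= a + bt_size t -> a <= y <= a + bt_size t -> P x -> P y.
Proof.
elim: t a x y => [|l IHl r IHr] a x y /= Pedge Hx Hy.
  by have -> : y = x by lia.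
have Pl u v : (u, v) \in edges a l -> P u <-> P v.
  by move=> H; apply: Pedge; rewrite inE mem_cat H orbT.
have Pr u v : (u, v) \in edges (a + bt_size l).+1 r -> P u <-> P v.
  by move=> H; apply: Pedge; rewrite inE mem_cat H !orbT.
have Pab : P a <-> P (a + (bt_size l + bt_size r).+1).
  by apply: Pedge; rewrite inE eqxx.
have [le_xk|lt_kx] := leqP x (a + bt_size l);
  have [le_yk|lt_ky] := leqP y (a + bt_size l).
- by apply: (IHl a) => //; lia.
- move=> /(IHl a x a Pl)-/(_ ltac:(lia) ltac:(lia))/Pab.
  by apply: (IHr _ _ _ Pr); lia.
- move=> /(IHr _ x (a + (bt_size l + bt_size r).+1) Pr).
  move=> /(_ ltac:(lia) ltac:(lia))/Pab.
  by apply: (IHl a) => //; lia.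
- by apply: (IHr (a + bt_size l).+1) => //; lia.
Qed.

(** Identifies the recursion with f: the last two clauses are the maximality conditions defining
    [i'] and [j'], and [j' = i] is the value prescribed when [(i, j)] is the only edge at [i]. *)
Lemma flipsP a t i j i' j' : ((i, j), (i', j')) \in flips a t ->
  [/\ [/\ a <= i', i' < i, i <= j', j' < j & j <= a + bt_size t],
      (i, j) \in edges a t, (i', j) \in edges a t,
      j' = i \/ (i, j') \in edges a t &
      (forall x, (x, j) \in edges a t -> x < i -> x <= i') /\
      (forall y, (i, y) \in edges a t -> y <= j /\ (y < j -> y <= j'))].
Proof.
elim: t a => //= l IHl r IHr a; rewrite !mem_cat => /or3P[]; last 2 first.
- move=> /IHl[[h1 h2 h3 h4 h5] e1 e2 e3 [mi mj]]; split; first by split; lia.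
  + by rewrite inE mem_cat e1 orbT.
  + by rewrite inE mem_cat e2 orbT.
  + by case: e3 => [->|e3]; [left | right; rewrite inE mem_cat e3 orbT].
  split=> [x|y]; rewrite inE mem_cat xpair_eqE.
    case/or3P=> [|/mi //|/edges_bound[]]; first by lia.
    by lia.
  by case/or3P=> [|/mj //|/edges_bound[]]; lia.
- move=> /IHr[[h1 h2 h3 h4 h5] e1 e2 e3 [mi mj]]; split; first by split; lia.
  + by rewrite inE mem_cat e1 !orbT.
  + by rewrite inE mem_cat e2 !orbT.
  + by case: e3 => [->|e3]; [left | right; rewrite inE mem_cat e3 !orbT].
  split=> [x|y]; rewrite inE mem_cat xpair_eqE.
    by case/or3P=> [|/edges_bound[]|/mi //]; lia.
  by case/or3P=> [|/edges_bound[]|/mj //]; lia.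
case: r IHr => // rl rr _; rewrite inE !xpair_eqE /=.
case/andP=> /andP[/eqP-> /eqP->] /andP[/eqP-> /eqP->].
set c := (a + bt_size l).+1.
split; first by split; lia.
- by rewrite /c !inE mem_cat !inE !xpair_eqE; lia.
- by rewrite inE eqxx.
- case: rl => [|rl1 rl2] /=; first by left; rewrite addn0.
  by right; rewrite !(inE, mem_cat) eqxx !orbT.
split=> [x|y]; rewrite !(inE, mem_cat) !xpair_eqE.
  case/or4P=> [|/edges_bound[]||]; rewrite -/c; try by lia.
  by case/orP=> /edges_bound[]; lia.
case/or4P=> [|/edges_bound[]||]; rewrite -/c; try by lia.
by case/orP=> /edges_bound[]; lia.
Qed.

(** The root of a left subtree shares its left end with the longer edge of its parent, so it is not
    in S. Only the root of the whole tree and the roots of right subtrees remain, which is why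
    [flips] has one entry per nonempty right subtree. *)
Lemma flips_complete a t i j : (i, j) \in edges a t ->
  (forall y, (i, y) \in edges a t -> y <= j) ->
  (i, j) = (a, a + bt_size t) \/ exists f, ((i, j), f) \in flips a t.
Proof.
elim: t a => //= l IHl r IHr a; rewrite inE mem_cat => /or3P[/eqP->||].
- by left.
- move=> Hij mj; right; have [ai|ne_ai] := eqVneq i a.
    have := mj (a + (bt_size l + bt_size r).+1).
    by rewrite ai inE eqxx /= => /(_ isT); have [] := edges_bound Hij; lia.
  have [|[]|[f Hf]] := IHl _ Hij.
  + by move=> y Hy; apply: mj; rewrite inE mem_cat Hy orbT.
  + by move/eqP: ne_ai.
  + by exists f; rewrite !mem_cat Hf orbT.
- move=> Hij mj; right; have [|[ei ej]|[f Hf]] := IHr _ Hij.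
  + by move=> y Hy; apply: mj; rewrite inE mem_cat Hy !orbT.
  + case: r IHr Hij mj ei ej => // rl rr _ _ _ -> -> /=.
    exists (a, (a + bt_size l).+1 + bt_size rl).
    rewrite inE; apply/orP; left; apply/eqP; congr (_, _, _).
    by lia.
  + by exists f; rewrite !mem_cat Hf !orbT.
Qed.

(* A face F is completed to a tree greedily: the root of an interval is split at
   the largest admissible gap. Splitting at a smaller gap would leave an edge of S
   whose flip stays inside the closure without that edge being in F. *)
Section Completion.

Variables (n : nat) (E : nat -> nat -> Prop).
Hypothesis E_lt : forall x y, E x y -> x < y.
Hypothesis E_nc : forall i j k l, i < j -> j < k -> k < l -> E i k -> E j l -> False.
Hypothesis E_exit : forall c v, c <= v -> v <= n -> (0 < c) || (v < n) ->
  exists x y, E x y /\ ((c <= x <= v) && (v < y <= n) || (x < c) && (c <= y <= v)).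

Notation R := (reach E).

Variable F : nat -> nat -> Prop.
Hypothesis F_lt : forall x y, F x y -> x < y.
Hypothesis F_reach : forall x y, F x y -> R x y.
Hypothesis F_nc : forall i j k l, i < j -> j < k -> k < l -> F i k -> F j l -> False.
Hypothesis F_alt : forall i j k, F i j -> F j k -> False.

(* On the interval of t, and with M the edge set of t: M lies in the closure,
   F is contained in M, and S_T(M) is contained in F. *)
Definition completes a t :=
  [/\ forall x y, (x, y) \in edges a t -> R x y,
      forall x y, a <= x -> y <= a + bt_size t -> F x y -> (x, y) \in edges a t
    & forall e f, (e, f) \in flips a t -> R f.1 f.2 -> F e.1 e.2].

Lemma completes_reach a t : completes a t -> R a (a + bt_size t).
Proof.
case: t => [|l r] [Rt _ _]; first by rewrite addn0; apply: reach_refl.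
by apply: Rt; rewrite inE eqxx.
Qed.

Lemma completes_node a l r : completes a (Node l r) ->
  completes a l /\ completes (a + bt_size l).+1 r.
Proof.
move=> [Rt Ft St]; split; split.
- by move=> x y H; apply: Rt; rewrite inE mem_cat H orbT.
- move=> x y le_ax le_y Fxy; have := Ft x y le_ax _ Fxy.
  rewrite inE mem_cat => /(_ ltac:(simpl; lia)) /or3P[|//|/edges_bound[]]; last by lia.
  by rewrite xpair_eqE /=; lia.
- by move=> e f H; apply: St; rewrite !mem_cat H orbT.
- by move=> x y H; apply: Rt; rewrite inE mem_cat H !orbT.
- move=> x y le_ax le_y Fxy; have := Ft x y _ _ Fxy.
  rewrite inE mem_cat => /(_ ltac:(lia) ltac:(simpl; lia)) /or3P[|/edges_bound[]|//].
    by rewrite xpair_eqE /=; lia.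
  by lia.
- by move=> e f H; apply: St; rewrite !mem_cat H !orbT.
Qed.

(** The conditions that a completion imposes on [k], the last vertex of its left subtree, without
    reference to the tree. *)
Definition candidate a b k := [/\ a <= k < b, R a k, R k.+1 b &
  forall x y, a <= x -> x <= k -> k < y -> y <= b -> F x y -> x = a /\ y = b].

Lemma completes_candidate a l r : completes a (Node l r) ->
  candidate a (a + bt_size (Node l r)) (a + bt_size l).
Proof.
move=> ct; have [cl cr] := completes_node ct; split=> /=.
- by lia.
- exact: completes_reach cl.
- by have := completes_reach cr; rewrite addSn addnS addnA.
move=> x y le_ax le_xk lt_ky le_y Fxy; case: ct => _ /(_ x y le_ax le_y Fxy).
by rewrite inE mem_cat xpair_eqE /= => /or3P[|/edges_bound[]|/edges_bound[]]; lia.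
Qed.

(** Let [c] be the first and [m] the splitting vertex of the right subtree. A candidate [k] beyond
    the left subtree is also one for the right subtree, so [k <= m] by induction. The paths from [a]
    to [k] and from [c] to [m] then interleave and [a] reaches [m]: the flip of [(c, b)] is in the
    closure, so [(c, b)] belongs to F. But this edge passes over the gap after [k] and does not
    start at [a]. *)
Lemma completes_max_candidate a l r k : completes a (Node l r) ->
  candidate a (a + bt_size (Node l r)) k -> k <= a + bt_size l.
Proof.
elim: r a l k => [|rl _ rr IHrr] a l k ct [hk Rak Rkb Fk].
  by simpl in *; lia.
have [cl cr] := completes_node ct.
rewrite leqNgt; apply/negP => lt_lk.
set b := a + bt_size (Node l (Node rl rr)) in hk Rkb Fk.
set c := (a + bt_size l).+1 in cr.
have eb : c + bt_size (Node rl rr) = b by rewrite /b /c /=; lia.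
have cck : candidate c (c + bt_size (Node rl rr)) k.
  have Rcb := completes_reach cr; rewrite eb in Rcb *.
  split=> //; first by lia.
    by apply: (reach_meet_right E_lt E_nc Rak Rcb); lia.
  by move=> x y ? ? ? ? Fxy; have [] := Fk x y _ _ _ _ Fxy; lia.
have le_km : k <= c + bt_size rl by exact: IHrr cr cck.
have [crl crr] := completes_node cr.
have Ram : R a (c + bt_size rl).
  by apply: (reach_meet_left E_lt E_nc Rak (completes_reach crl)); lia.
have Fcb : F c b.
  by case: ct => _ _ /(_ (c, b) (a, c + bt_size rl)); apply => //; rewrite inE eqxx.
by have [] := Fk c b _ _ _ _ Fcb; lia.
Qed.

(** Both root splits are the largest candidate, hence equal; recursion does the rest. *)
Lemma completes_uniq a t1 t2 : completes a t1 -> completes a t2 ->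
  bt_size t1 = bt_size t2 -> t1 = t2.
Proof.
elim: t1 a t2 => [|l1 IHl r1 IHr] a [|l2 r2] // c1 c2 eq_sz.
have eq_l : bt_size l1 = bt_size l2.
  have := completes_candidate c1; rewrite eq_sz => /(completes_max_candidate c2).
  by have := completes_candidate c2; rewrite -eq_sz => /(completes_max_candidate c1); lia.
have [cl1 cr1] := completes_node c1; have [cl2 cr2] := completes_node c2.
rewrite -eq_l in cr2.
by rewrite (IHl a l2) // (IHr _ r2 cr1 cr2) //; move: eq_sz => /=; lia.
Qed.

(** Here [j] is the far end of the longest edge of F at [a] short of [b], or [a] itself. By
    [reach_gap] an edge of F over the gap starts at or before [j]. If it starts at [a] it must end
    at [b], by maximality of [j]; starting at [j] it would violate alternation, and in between it
    would cross [(a, j)]. *)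
Lemma candidate_exists a b : a < b -> b <= n -> R a b -> exists k, candidate a b k.
Proof.
move=> lt_ab le_bn Rab.
have [||j [Ej lt_jb] max_j] := @ex_maxP (fun j => (F a j \/ j = a) /\ j < b) b.
- by exists a; split=> //; right.
- by move=> k []; lia.
have Raj : R a j by case: Ej => [/F_reach //|->]; apply: reach_refl.
have le_aj : a <= j by case: Ej => [/F_lt|]; lia.
have [|k [hk Rak Rkb covers]] := reach_gap E_lt E_nc E_exit Rab _ le_bn Raj.
  by lia.
exists k; split=> //; first by lia.
move=> x y le_ax le_xk lt_ky le_yb Fxy.
have le_xj : x <= j by apply: (covers x y) => //; apply: F_reach.
have [eq_xa|ne_xa] := eqVneq x a.
  rewrite -eq_xa in max_j *; split=> //; apply/eqP; rewrite eqn_leq le_yb leqNgt.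
  by apply/negP => lt_yb; have := max_j y (conj (or_introl Fxy) lt_yb); lia.
case: Ej => [Faj|eq_ja]; last by lia.
have [eq_xj|ne_xj] := eqVneq x j; first by rewrite eq_xj in Fxy; case: (F_alt Faj Fxy).
by case: (F_nc _ _ _ Faj Fxy); lia.
Qed.

Lemma completes_exists a b : a <= b -> b <= n -> R a b ->
  exists2 t, a + bt_size t = b & completes a t.
Proof.
have [m] := ubnP (b - a); elim: m => // m IHm in a b * => le_m.
rewrite leq_eqVlt => /orP[/eqP <-|lt_ab] le_bn Rab.
  exists Leaf; rewrite ?addn0 //=; split=> //= x y le_ax le_ya /F_lt; lia.
have [||k [hk Rak Rkb covers] max_k] := @ex_maxP (candidate a b) b.
- exact: candidate_exists.
- by move=> k []; lia.
have [||||l el cl] := IHm a k; try (assumption || lia).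
have [||||r er cr] := IHm k.+1 b; try (assumption || lia).
have {el} ek : k = a + bt_size l by [].
have eb : a + bt_size (Node l r) = b by rewrite -er ek /=; lia.
have Ft x y : a <= x -> y <= b -> F x y -> (x, y) \in edges a (Node l r).
  move=> le_ax le_yb Fxy; have lt_xy := F_lt Fxy.
  rewrite inE mem_cat -ek; have [le_yk|lt_ky] := leqP y k.
    by case: cl => _ /(_ x y le_ax) ->; rewrite ?orbT -?ek.
  have [le_xk|lt_kx] := leqP x k.
    have [] := covers x y le_ax le_xk lt_ky le_yb Fxy => -> ->.
    by rewrite -eb eqxx.
  by case: cr => _ /(_ x y lt_kx) ->; rewrite ?orbT ?er.
exists (Node l r) => //; split; last 1 first.
- move=> e f; rewrite !mem_cat -ek => /or3P[||]; last 2 first.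
  + by case: cl => _ _; apply.
  + by case: cr => _ _; apply.
  case: r cr er eb Ft => // rl rr cr er eb Ft.
  rewrite inE eb => /eqP[-> ->] /= Ram; apply: contrapT => nFkb.
  have [crl crr] := completes_node cr.
  (* If the flip of [(k.+1, b)] is in the closure while this edge is not in F, cutting at the split
     of the right subtree is admissible as well: of the tree edges, only the root and [(k.+1, b)]
     pass over that later gap. This contradicts the choice of [k]. *)
  suff /max_k : candidate a b (k.+1 + bt_size rl) by lia.
  have e' : (k.+1 + bt_size rl).+1 + bt_size rr = b by rewrite -er /=; lia.
  split=> //; first by lia.
    by rewrite -e'; apply: completes_reach.
  move=> x y le_ax le_xm lt_my le_yb Fxy.
  have := Ft x y le_ax le_yb Fxy; rewrite !(inE, mem_cat) eb -ek !xpair_eqE.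
  case/or4P=> [|/edges_bound[]||]; try by lia.
    move=> /andP[/eqP ex /eqP ey]; case: nFkb; move: Fxy.
    by rewrite ex ey -er.
  by case/orP=> /edges_bound[]; lia.
- move=> x y; rewrite inE mem_cat eb -ek => /or3P[/eqP[-> ->] //||].
    by case: cl => Rl _ _; apply: Rl.
  by case: cr => Rr _ _; apply: Rr.
- by move=> x y le_ax; rewrite eb; apply: Ft.
Qed.

End Completion.

(** * Faces and facets *)

Section AcyclicGraphs.

Variable n : nat.
Notation V := 'I_n.+1.
Implicit Types G M : {set V * V}.

Lemma is_graphP G : reflect (forall i j, (i, j) \in G -> i < j) (is_graph G).
Proof.
apply: (iffP forall_inP) => [H i j /H //|H [i j]]; exact: H.
Qed.

Lemma adj_sym G : symmetric (adj G).
Proof. by move=> i j; rewrite /adj orbC. Qed.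

Lemma next_next_neq (X : eqType) (s : seq X) x :
  uniq s -> 2 < size s -> x \in s -> next s (next s x) != x.
Proof.
move=> us szs xs; have [k s' eqs] := rot_to xs.
rewrite -!(next_rot k us).
move: us szs; rewrite -(rot_uniq k) -(size_rot k s) eqs {eqs}.
case: s' => [|y [|z s']] //= /and3P[].
rewrite !inE !negb_or => /andP[ne_xy /andP[ne_xz _]] _ _ _.
by rewrite eqxx [y == x]eq_sym (negPf ne_xy) eqxx eq_sym.
Qed.

(* The shortest edge of a cycle would be nested inside two edges that cross. *)
Lemma acyclic_noncrossing_alternating G :
  is_graph G -> noncrossing G -> alternating G -> acyclic G.
Proof.
move=> /is_graphP ltG ncG altG s szs /andP[cyc us].
have altG' i j k : (i, j) \in G -> (j, k) \in G -> False.
  by move=> Gij Gjk; apply: (altG i j k); rewrite ?ltG.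
have [x0 x0s] : exists x0, x0 \in s by case: s szs {cyc us} => // x s; exists x; rewrite mem_head.
(* The length of the edge from [x] to its successor: one of the two truncated differences is always
   0. *)
pose d (x : V) := (x - next s x) + (next s x - x).
case: (arg_minnP d x0s) => x xs min_x.
pose y := next s x; pose z := next s y; pose u := prev s x.
have ys : y \in s by rewrite mem_next.
have us' : u \in s by rewrite mem_prev.
have next_u : next s u = x by rewrite /u next_prev.
have ne_zx : z != x by apply: next_next_neq.
have ne_uy : u != y.
  by apply/eqP => eq_uy; move: ne_zx; rewrite /z -eq_uy next_u eqxx.
have {}min_y := min_x y ys; have {min_x}min_u := min_x u us'.
rewrite /d next_u -/y -/z in min_y min_u.
have Axy : adj G x y by apply: next_cycle.
have Ayz : adj G y z by apply: next_cycle.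
have Aux : adj G u x by apply: prev_cycle.
have ne_zx' : z <> x :> nat by move/val_inj/eqP; apply/negP.
have ne_uy' : u <> y :> nat by move/val_inj/eqP; apply/negP.
case/orP: Axy => Gxy; have lt_xy := ltG _ _ Gxy.
  case/orP: Ayz => Gyz; first exact: altG' Gxy Gyz.
  case/orP: Aux => Gux; first exact: altG' Gux Gxy.
  have := ltG _ _ Gyz; have := ltG _ _ Gux => ? ?.
  by apply: (ncG z x y u) => //; lia.
case/orP: Ayz => Gyz; last exact: altG' Gyz Gxy.
case/orP: Aux => Gux; last exact: altG' Gxy Gux.
have := ltG _ _ Gyz; have := ltG _ _ Gux => ? ?.
by apply: (ncG u y x z) => //; lia.
Qed.

(** A simple path joining the ends of [e] without using it closes up with [e] to a cycle. It has
    more than two vertices, since a single step would have to be [e] itself. *)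
Lemma acyclic_bridge G e : is_graph G -> acyclic G -> e \in G ->
  ~~ connect (adj (G :\ e)) e.1 e.2.
Proof.
case: e => i j /is_graphP ltG acG Gij; apply/negP => /connectP[p0 ep0 elast] /=.
have {p0 ep0 elast} [p ep [up elast]] : exists2 p,
    path (adj (G :\ (i, j))) i p & uniq (i :: p) /\ j = last i p.
  by case/shortenP: ep0 elast => p *; exists p.
have lt_ij := ltG _ _ Gij.
have sub : subrel (adj (G :\ (i, j))) (adj G).
  by move=> x y; rewrite /adj !inE => /orP[]/andP[_ ->]; rewrite ?orbT.
apply: (acG (i :: p)).
  case: p ep up elast => [|x [|y p]] //= => [_ _ eq_ji|]; first by rewrite eq_ji ltnn in lt_ij.
  rewrite andbT => + _ eq_jx; rewrite -eq_jx /adj !inE eqxx /= => /andP[_ /ltG].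
  by rewrite ltnNge ltnW.
rewrite /ucycle up andbT /= rcons_path (sub_path sub ep) -elast /=.
by rewrite /adj Gij orbT.
Qed.

(** Every edge of an acyclic graph is a bridge, so dropping one disconnects its ends. *)
Lemma connected_sub_acyclic M G : is_graph G -> acyclic G -> M \subset G ->
  connected_graph M -> M = G.
Proof.
move=> gG acG sMG conM; apply/eqP; rewrite finset.eqEsubset sMG; apply/fintype.subsetP => e Ge.
apply: contraT => nMe; have := acyclic_bridge gG acG Ge; rewrite (connect_sub _ (conM _ _)) //.
move=> x y Axy; apply: connect1; move: Axy; rewrite /adj !inE.
have sub f : f \in M -> (f != e) && (f \in G).
  by move=> Mf; rewrite (fintype.subsetP sMG) // andbT; apply: contraNneq nMe => <-.
by case/orP=> /sub->; rewrite ?orbT.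
Qed.

End AcyclicGraphs.

(** * The transitive closure in terms of increasing paths *)

Section ClosureOfTree.

Variable n : nat.
Notation V := 'I_n.+1.
Implicit Types G M F : {set V * V}.

(** Carries a graph on ordinals over to natural numbers, where the interval arguments take place. *)
Definition nat_edge G (x y : nat) : Prop :=
  exists i j : V, [/\ (i, j) \in G, x = i & y = j].

Lemma nat_edgeP G (i j : V) : nat_edge G i j <-> (i, j) \in G.
Proof.
split=> [[i' [j' [Gij /val_inj-> /val_inj->]]] //|Gij].
by exists i, j.
Qed.

Lemma nat_edge_lt G x y : is_graph G -> nat_edge G x y -> x < y.
Proof. by move=> /is_graphP ltG [i [j [/ltG ? -> ->]]]. Qed.

Lemma nat_edge_nc G i j k l : noncrossing G -> i < j -> j < k -> k < l ->
  nat_edge G i k -> nat_edge G j l -> False.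
Proof.
move=> ncG h1 h2 h3 [i' [k' [Gik ei ek]]] [j' [l' [Gjl ej el]]]; subst.
exact: (ncG i' j' k' l').
Qed.

Lemma nat_edge_alt G i j k : is_graph G -> alternating G ->
  nat_edge G i j -> nat_edge G j k -> False.
Proof.
move=> /is_graphP ltG altG [i' [j' [Gij _ ->]]] [j2 [k' [Gjk /val_inj eqj _]]].
by rewrite -eqj in Gjk; apply: (altG i' j' k'); rewrite ?ltG.
Qed.

Lemma nat_edge_exit G c v : is_graph G -> connected_graph G ->
  c <= v -> v <= n -> (0 < c) || (v < n) ->
  exists x y, nat_edge G x y /\
    ((c <= x <= v) && (v < y <= n) || (x < c) && (c <= y <= v)).
Proof.
move=> gG conG le_cv le_vn out; apply: contrapT => noexit.
pose A : pred V := fun x => c <= x <= v.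
have clA : closed (adj G) A.
  suff edgeA x y : (x, y) \in G -> (x \in A) = (y \in A).
    by move=> x y /orP[/edgeA|/edgeA/esym].
  move=> Gxy; have {Gxy} Exy : nat_edge G x y by exists x, y.
  have le_xn := ltn_ord x; have le_yn := ltn_ord y.
  have : ~ ((c <= x <= v) && (v < y <= n) || (x < c) && (c <= y <= v)).
    by move=> H; apply: noexit; exists x, y.
  have := nat_edge_lt gG Exy.
  by rewrite !unfold_in /A; lia.
have Ac : (inord c : V) \in A by rewrite unfold_in /A inordK; lia.
case/orP: out => [lt_0c|lt_vn].
  have := closed_connect clA (conG (inord c) ord0); rewrite Ac => /esym.
  by rewrite unfold_in /A /=; lia.
have := closed_connect clA (conG (inord c) ord_max); rewrite Ac => /esym.
by rewrite unfold_in /A /=; lia.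
Qed.

Lemma transitive_closureP G (i j : V) : is_graph G ->
  (i, j) \in transitive_closure G <-> i < j /\ reach (nat_edge G) i j.
Proof.
move=> gG; rewrite inE; split.
  move/asboolP => [s /=]; elim: s i => [|k s IHs] i /=.
    by rewrite andbT => /andP[lt_ij Gij]; split=> //; apply/reach1/nat_edgeP.
  move=> /andP[/andP[lt_ik Gik] /IHs[lt_kj Rkj]]; split; first exact: ltn_trans lt_kj.
  by apply: reach_step Rkj; apply/nat_edgeP.
move=> [lt_ij Rij]; apply/asboolP => /=.
have paths : forall x y, reach (nat_edge G) x y -> forall i j : V, x = i -> y = j -> x < y ->
    exists s, path (fun i j : V => (i < j) && ((i, j) \in G)) i (rcons s j).
  move=> x y; elim=> [z i' j' _ _|a b c [i1 [k [Gik -> ->]]] Rbc IH i' j' /val_inj<- ej _].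
    by rewrite ltnn.
  have lt_ik := is_graphP _ gG _ _ Gik.
  have := reach_le (fun x y => @nat_edge_lt G x y gG) Rbc.
  rewrite leq_eqVlt => /orP[/eqP|lt_kc].
    rewrite ej => /val_inj <-; exists [::] => /=; by rewrite lt_ik Gik.
  by have [s ps] := IH k j' erefl ej lt_kc; exists (k :: s); rewrite /= lt_ik Gik.
exact: (paths i j Rij i j erefl erefl lt_ij).
Qed.

End ClosureOfTree.

(** * Binary trees as spanning trees, with their sets S and maps f *)

Section TreeSets.

Variable n : nat.
Notation V := 'I_n.+1.
Implicit Types G M F : {set V * V}.

Definition tree_set t : {set V * V} :=
  [set e : V * V | (e.1 : nat, e.2 : nat) \in edges 0 t]%SET.

Lemma in_tree_set t (i j : V) : ((i, j) \in tree_set t) = ((i : nat, j : nat) \in edges 0 t).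
Proof. by rewrite inE. Qed.

Lemma tree_set_graph t : is_graph (tree_set t).
Proof. by apply/is_graphP => i j; rewrite in_tree_set => /edges_bound[]. Qed.

Lemma tree_set_nc t : noncrossing (tree_set t).
Proof.
move=> i j k l lt_ij lt_jk lt_kl []; rewrite !in_tree_set => Hik Hjl.
exact: edges_nc lt_ij lt_jk lt_kl Hik Hjl.
Qed.

Lemma tree_set_alt t : alternating (tree_set t).
Proof.
move=> i j k _ _ []; rewrite !in_tree_set => Hij Hjk.
exact: edges_alt Hij Hjk.
Qed.

Section FullSize.

Variable t : bt.
Hypothesis szt : bt_size t = n.

Lemma edges_ord x y : (x, y) \in edges 0 t ->
  exists i j : V, [/\ x = i, y = j & (i, j) \in tree_set t].
Proof.
move=> Hxy; have [_ lt_xy le_y] := edges_bound Hxy.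
have lt_y : y < n.+1 by lia.
have lt_x : x < n.+1 by lia.
by exists (Ordinal lt_x), (Ordinal lt_y); rewrite in_tree_set.
Qed.

Lemma tree_set_connected : connected_graph (tree_set t).
Proof.
move=> i j; pose P x := connect (adj (tree_set t)) i (inord x).
suff : P j by rewrite /P inord_val.
apply: (@edges_connected 0 t P i); last by rewrite /P inord_val connect0.
- move=> u v /edges_ord[x [y [-> -> Gxy]]]; rewrite /P !inord_val.
  have Axy : adj (tree_set t) x y by rewrite /adj Gxy.
  split=> /connect_trans; apply; apply: connect1 => //.
  by rewrite adj_sym.
- by have := ltn_ord i; lia.
- by have := ltn_ord j; lia.
Qed.

Lemma tree_set_tree : is_tree (tree_set t).
Proof.
have gt := tree_set_graph t.
split; last exact: tree_set_connected.
split=> //; apply: acyclic_noncrossing_alternating => //.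
  exact: tree_set_nc.
exact: tree_set_alt.
Qed.

Lemma card_tree_set : #|tree_set t| = n.
Proof.
pose g (e : nat * nat) : V * V := (inord e.1, inord e.2).
have valg e : e \in edges 0 t -> (val (g e).1, val (g e).2) = e.
  by case: e => x y /edges_ord[i [j [-> -> _]]]; rewrite /g /= !inord_val.
have inj_g : {in edges 0 t &, injective g}.
  by move=> e f et ft eg; rewrite -(valg e) // -(valg f) // eg.
have ug : uniq (map g (edges 0 t)) by rewrite map_inj_in_uniq ?uniq_edges.
rewrite -[RHS]szt -(size_edges 0 t) -(size_map g) -(card_uniqP ug).
apply: eq_card => -[i j]; rewrite in_tree_set; apply/idP/mapP => [Hij|[e et eg]].
  by exists (i : nat, j : nat) => //; rewrite /g /= !inord_val.
by have := valg e et; rewrite -eg /= => ->.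
Qed.

Lemma biggestE (P : pred V) d k : is_biggest P k -> biggest P d = k.
Proof.
rewrite /biggest => bk; case: pickP => [k' bk'|/(_ k)]; last by rewrite bk.
apply/val_inj/eqP; rewrite eqn_leq.
case/andP: bk bk' => Pk /forallP maxk /andP[Pk' /forallP maxk'].
by rewrite (implyP (maxk k')) // (implyP (maxk' k)).
Qed.

(** In an alternating graph no edge ends where another one starts, so the condition that [i] is a
    left vertex follows from the existence of [(i, j)]. *)
Lemma mem_S_set (i j : V) : (i, j) \in S_set (tree_set t) <->
  (i, j) \in tree_set t /\ forall y : V, (i, y) \in tree_set t -> y <= j.
Proof.
have ltG := is_graphP _ (tree_set_graph t).
have altG := @nat_edge_alt _ _ _ _ _ (tree_set_graph t) (@tree_set_alt t).
rewrite inE /= inE; split=> [/andP[/forall_inP leftG /andP[Aij /forallP maxj]]|[Gij maxj]].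
  split; last by move=> y Giy; apply: (implyP (maxj y)); rewrite /adj Giy.
  case/orP: Aij => // Gji; have := leftG _ Gji; rewrite /incident /= eqxx orbT /=.
  by move=> /eqP eq_ji; have := ltG _ _ Gji; rewrite eq_ji ltnn.
have left_i k : (k, i) \in tree_set t -> False.
  by move=> /nat_edgeP Gki; apply: altG Gki _; apply/nat_edgeP; exact: Gij.
apply/andP; split.
  apply/forall_inP => -[x y] Gxy; apply/implyP; rewrite /incident /=.
  by case/orP=> // /eqP eq_yi; rewrite eq_yi in Gxy; case: (left_i x).
rewrite /is_biggest /adj Gij /=; apply/forallP => k; apply/implyP.
by case/orP=> [/maxj //|/left_i].
Qed.

Lemma mem_S_set_flips (i j : V) : (i, j) != (ord0, ord_max) ->
  (i, j) \in S_set (tree_set t) ->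
  exists f, ((i : nat, j : nat), f) \in flips 0 t.
Proof.
move=> ne_ij /mem_S_set[Gij maxj].
have [||[ei ej]|//] := @flips_complete 0 t i j; first by rewrite -in_tree_set.
  move=> y Hiy; have [i' [y' [ei ey Giy]]] := edges_ord Hiy.
  by rewrite ey; apply: maxj; rewrite (val_inj ei).
case/eqP: ne_ij; congr (_, _); apply/val_inj => //=.
by rewrite ej szt add0n.
Qed.

Lemma f_map_flips (i j : V) f : ((i : nat, j : nat), f) \in flips 0 t ->
  [/\ (i, j) \in S_set (tree_set t), (i, j) != (ord0, ord_max) &
    let f' := f_map (tree_set t) (i, j) in
    [/\ f.1 = f'.1, f.2 = f'.2 & f.1 < f.2]].
Proof.
case: f => i0 j0 Hf; have [[_ lt_i0i le_ij0 lt_j0j le_j] Hij Hi0j Hij0 [maxi maxj]] := flipsP Hf.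
have ltG := is_graphP _ (tree_set_graph t).
have [i' [_ [ei' _ _]]] := edges_ord Hi0j.
have Gij : (i, j) \in tree_set t by rewrite in_tree_set.
have SGij : (i, j) \in S_set (tree_set t).
  by apply/mem_S_set; split=> // y; rewrite in_tree_set => /maxj[].
split=> //.
  by apply/eqP => -[ei _]; rewrite ei in lt_i0i.
have lt_j0n : j0 < n.+1 by have := ltn_ord j; lia.
pose j' : V := Ordinal lt_j0n.
have -> : f_map (tree_set t) (i, j) = (i', j').
  congr (_, _).
    apply: biggestE; apply/andP; split.
      by rewrite /= -ei' lt_i0i in_tree_set -ei'.
    apply/forallP => k; apply/implyP => /andP[lt_ki]; rewrite in_tree_set => /maxi.
    by rewrite -ei'; apply.
  case: ifPn => [/forall_inP only_ij|].
    apply/val_inj => /=; case: Hij0 => [-> //|Hij0].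
    have Gij0 : (i, j') \in tree_set t by rewrite in_tree_set.
    have := only_ij _ Gij0; rewrite /incident eqxx /= => /eqP[ej'].
    by move: lt_j0j; rewrite -ej' /= ltnn.
  (* If the flip has [j0 = i], no edge from [i] is shorter than [(i, j)], and by alternation none
     ends at [i]; so [(i, j)] is the only edge at [i], against [nonly]. *)
  case: Hij0 => [ej0|Hij0] nonly.
    case/negP: nonly; apply/forall_inP => -[x y] Gxy; apply/implyP.
    case/orP => /eqP /= ex; rewrite ex in Gxy *.
      have lt_iy := ltG _ _ Gxy; move: Gxy; rewrite in_tree_set => /maxj[le_yj le_yj0].
      apply/eqP; congr (_, _); apply/val_inj/eqP; rewrite eqn_leq le_yj leqNgt.
      by apply/negP => /le_yj0; lia.
    by case: (@tree_set_alt t x i j (ltG _ _ Gxy) (ltG _ _ Gij)).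
  apply: biggestE; apply/andP; split; first by rewrite /= lt_j0j in_tree_set.
  by apply/forallP => k; apply/implyP => /andP[lt_kj]; rewrite in_tree_set => /maxj[_]; apply.
by split=> //=; lia.
Qed.

End FullSize.

End TreeSets.

(** * Each face lies in the interval of exactly one facet *)

Section Facets.

Variable n : nat.
Notation V := 'I_n.+1.
Implicit Types G M F : {set V * V}.

Definition face T F := [/\ noncrossing F, alternating F & F \subset transitive_closure T].

Definition facet T M :=
  [/\ noncrossing M, alternating M & spanning_tree_of M (transitive_closure T)].

Variable T : {set V * V}.
Hypothesis treeT : is_tree T.
Hypothesis ncT : noncrossing T.

Let graphT : is_graph T. Proof. by case: treeT => -[]. Qed.

Let connT : connected_graph T. Proof. by case: treeT. Qed.

Notation E := (nat_edge T).

Let E_lt x y : E x y -> x < y. Proof. exact: nat_edge_lt. Qed.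

Let E_nc i j k l : i < j -> j < k -> k < l -> E i k -> E j l -> False.
Proof. exact: nat_edge_nc. Qed.

Let E_exit c v : c <= v -> v <= n -> (0 < c) || (v < n) ->
  exists x y, E x y /\ ((c <= x <= v) && (v < y <= n) || (x < c) && (c <= y <= v)).
Proof. exact: nat_edge_exit. Qed.

Lemma closure_graph : is_graph (transitive_closure T).
Proof. by apply/is_graphP => i j /(transitive_closureP _ _ graphT)[]. Qed.

Lemma face_graph F : face T F -> is_graph F.
Proof.
case=> _ _ sF; apply/is_graphP => i j Fij.
by apply: (is_graphP _ closure_graph); apply: (fintype.subsetP sF).
Qed.

Lemma facet_face M : facet T M -> face T M.
Proof. by case=> ncM altM []. Qed.

Lemma in_S_T M e : (e \in S_T T M) =
  [&& e != (ord0, ord_max), e \in S_set M & f_map M e \in transitive_closure T].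
Proof. by rewrite !inE -!andbA. Qed.

Lemma S_T_tree_set t e : bt_size t = n -> e \in S_T T (tree_set n t) <->
  exists2 f, ((e.1 : nat, e.2 : nat), f) \in flips 0 t & reach E f.1 f.2.
Proof.
case: e => i j szt /=; rewrite in_S_T; split.
  move=> /and3P[ne_ij Sij fTij].
  have [f Hf] := mem_S_set_flips szt ne_ij Sij; exists f => //.
  have [_ _ [ef1 ef2 _]] := f_map_flips szt Hf; rewrite ef1 ef2.
  move: fTij; case: (f_map (tree_set n t) (i, j)) => i' j' fTij.
  by have [] := (transitive_closureP i' j' graphT).1 fTij.
move=> [f Hf Rf]; have [-> -> /=] := f_map_flips szt Hf.
case: (f_map (tree_set n t) (i, j)) => i' j' [ef1 ef2 lt_f]; rewrite ef1 ef2 in lt_f Rf.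
exact/(transitive_closureP _ _ graphT).
Qed.

Lemma face_completes F : face T F -> exists t, [/\ bt_size t = n,
  completes E (nat_edge F) 0 t & forall t', bt_size t' = n ->
  completes E (nat_edge F) 0 t' -> t' = t].
Proof.
move=> fF; have gF := face_graph fF; have [ncF altF sF] := fF.
have F_lt x y : nat_edge F x y -> x < y by exact: nat_edge_lt.
have F_reach x y : nat_edge F x y -> reach E x y.
  move=> [i [j [Fij -> ->]]].
  by have [] := (transitive_closureP i j graphT).1 (fintype.subsetP sF _ Fij).
have F_nc i j k l : i < j -> j < k -> k < l -> nat_edge F i k -> nat_edge F j l -> False.
  exact: nat_edge_nc.
have F_alt i j k : nat_edge F i j -> nat_edge F j k -> False by exact: nat_edge_alt.
have R0n := reach_full E_lt E_nc E_exit.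
have [t szt ct] := completes_exists E_lt E_nc E_exit F_lt F_reach F_nc F_alt
  (leq0n n) (leqnn n) R0n.
exists t; split=> // t' szt' ct'.
by apply: (completes_uniq E_lt E_nc ct' ct); rewrite szt' -szt.
Qed.

Lemma completes_tree_set F t : bt_size t = n -> face T F ->
  completes E (nat_edge F) 0 t <->
  [/\ facet T (tree_set n t), F \subset tree_set n t & S_T T (tree_set n t) \subset F].
Proof.
move=> szt fF; split=> [[Rt Ft St]|[[ncM altM [treeM subM]] sFM sSF]].
  split.
  - split; [exact: tree_set_nc|exact: tree_set_alt|split; first exact: tree_set_tree].
    apply/fintype.subsetP => -[i j]; rewrite in_tree_set => Hij.
    apply/(transitive_closureP _ _ graphT); split; last exact: Rt.
    by case: (edges_bound Hij).
  - apply/fintype.subsetP => -[i j] Fij; rewrite in_tree_set; apply: Ft => //.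
      by rewrite szt add0n -ltnS.
    exact/nat_edgeP.
  - apply/fintype.subsetP => -[i j] /(S_T_tree_set _ szt)[f Hf Rf].
    by apply/nat_edgeP; apply: St Hf Rf.
split.
- move=> x y /(edges_ord szt)[i [j [-> -> Hij]]].
  by have [] := (transitive_closureP i j graphT).1 (fintype.subsetP subM _ Hij).
- move=> x y _ _ [i [j [Fij -> ->]]]; rewrite -in_tree_set.
  exact: (fintype.subsetP sFM).
- move=> [x y] [x' y'] Hf Rf; have [_ Hxy _ _ _] := flipsP Hf.
  have [i [j [ex ey _]]] := edges_ord szt Hxy; rewrite ex ey in Hf *.
  apply/nat_edgeP/(fintype.subsetP sSF)/(S_T_tree_set _ szt).
  by exists (x', y').
Qed.

(** Complete [M], seen as a face, to a binary tree: the result is acyclic and contains the connected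
    graph [M], so it equals [M]. *)
Lemma facet_tree_set M : facet T M -> exists2 t, bt_size t = n & M = tree_set n t.
Proof.
move=> fM; have [t [szt /(completes_tree_set szt (facet_face fM))[ft sMt _] _]] :=
  face_completes (facet_face fM).
exists t => //; have [_ _ [[_ conM] _]] := fM.
by have [[gt act] _] := tree_set_tree szt; apply: connected_sub_acyclic.
Qed.

Lemma card_facet M : facet T M -> #|M| = n.
Proof. by move=> /facet_tree_set[t szt ->]; apply: card_tree_set. Qed.

(** The edge [(ord0, ord_max)] belongs to every facet and is excluded from [S_T]. This keeps the
    size of [S_T] below [n], and so the exponents of the numerator. *)
Lemma S_T_proper M : 0 < n -> facet T M -> S_T T M \proper M.
Proof.
move=> n_gt0 /facet_tree_set[t szt ->]; apply/properP; split.
  apply/fintype.subsetP => -[i j] /(S_T_tree_set _ szt)[[i' j'] Hf _].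
  by have [_ Hij _ _ _] := flipsP Hf; rewrite in_tree_set.
exists (ord0, ord_max); last by rewrite !inE eqxx.
rewrite in_tree_set /=; case: t szt n_gt0 => [|l r] szt; first by rewrite -szt.
by rewrite inE /= xpair_eqE eqxx add0n -szt /= eqxx.
Qed.

Lemma face_facet F : face T F -> exists2 M,
  [/\ facet T M, F \subset M & S_T T M \subset F] &
  forall M', [/\ facet T M', F \subset M' & S_T T M' \subset F] -> M' = M.
Proof.
move=> fF; have [t [szt ct uniq_t]] := face_completes fF.
exists (tree_set n t); first exact/completes_tree_set.
move=> M' [fM']; have [t' szt' eM'] := facet_tree_set fM'; rewrite eM' in fM' *.
by move=> sF sS; rewrite (uniq_t t') //; apply/completes_tree_set.
Qed.

End Facets.

(** * Binomial sums over intervals and multiplicities with given support *)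

Section Counting.

(** For x in B outside A, the interval splits into the sets that contain x and those that do not,
    which are the intervals from A+x to B and from A to B-x; their sums add up by Pascal's rule. *)
Lemma sum_binomial_interval (X : finType) (A B : {set X}) t : A \subset B ->
  \sum_(F : {set X} | (A \subset F) && (F \subset B)) 'C(t, #|F|) =
  'C(t + (#|B| - #|A|), #|B|).
Proof.
have [m] := ubnP (#|B| - #|A|); elim: m => // m IHm in A B * => le_m sAB.
have le_AB := subset_leq_card sAB.
have [eqAB|neAB] := eqVneq A B.
  rewrite eqAB subnn addn0 (big_pred1 B) // => F.
  by rewrite /= [RHS]finset.eqEsubset andbC.
have /fintype.subsetPn[x Bx nAx] : ~~ (B \subset A).
  by apply: contra neAB => sBA; rewrite finset.eqEsubset sAB.
have cB : #|B| = #|B :\ x|.+1 by rewrite (cardsD1 x B) Bx.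
have cA : #|x |: A| = #|A|.+1 by rewrite cardsU1 nAx.
have sxAB : x |: A \subset B by rewrite finset.subUset finset.sub1set Bx.
have sABx : A \subset B :\ x by rewrite finset.subsetD1 sAB.
have ltAB : #|A| < #|B| by have := subset_leq_card sxAB; lia.
rewrite (bigID (fun F : {set X} => x \in F)) /=.
rewrite (eq_bigl (fun F : {set X} => (x |: A \subset F) && (F \subset B))); last first.
  by move=> F; rewrite finset.subUset finset.sub1set andbC andbA.
rewrite IHm //; last by lia.
rewrite (eq_bigl (fun F : {set X} => (A \subset F) && (F \subset B :\ x))); last first.
  by move=> F; rewrite finset.subsetD1 andbA.
rewrite IHm //; last by lia.
have -> : t + (#|B| - #|A|) = (t + (#|B :\ x| - #|A|)).+1 by lia.
rewrite cA cB binS; by congr ('C(_, _) + _); lia.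
Qed.

(** Lowering each multiplicity on F by one leaves an arbitrary [#|F|]-tuple of naturals with sum at
    most [t - #|F|], as counted by [card_partial_ord_partitions]. The map [g] below is the inverse
    operation. *)
Lemma card_ffun_support (X : finType) (F : {set X}) t :
  #|[set m : {ffun X -> 'I_t.+1} |
      ([set e | 0 < m e] == F) && (\sum_e (m e : nat) <= t)]%SET| = 'C(t, #|F|).
Proof.
have [le_Ft|lt_tF] := leqP #|F| t; last first.
  rewrite bin_small //; apply/eqP; rewrite cards_eq0; apply/eqP/setP => m.
  rewrite !inE; apply/negP => /andP[/eqP supp_m le_mt]; move: lt_tF.
  rewrite -supp_m ltnNge => /negP; apply; apply: leq_trans le_mt.
  rewrite -sum1_card big_mkcond /=; apply: leq_sum => e _.
  by rewrite inE; case: (m e : nat).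
have [N eNt] : exists N, t = #|F| + N by exists (t - #|F|); rewrite subnKC.
rewrite {le_Ft}eNt -card_partial_ord_partitions; set k := #|F|.
pose g (s : k.-tuple 'I_N.+1) : {ffun X -> 'I_(k + N).+1} :=
  [ffun e => inord (if e \in F then (nth ord0 s (index e (enum F)) : 'I_N.+1).+1 else 0)].
have gE s e : g s e = (if e \in F then (nth ord0 s (index e (enum F)) : 'I_N.+1).+1 else 0) :> nat.
  rewrite ffunE inordK //; case: ifP => // eF.
  rewrite ltnS (leq_trans (ltn_ord _)) // -add1n leq_add2r /k.
  by apply/card_gt0P; exists e.
have szF : size (enum F) = k by rewrite -cardE.
have sumF (h : X -> nat) : \sum_(e in F) h e = \sum_(e <- enum F) h e by rewrite big_enum.
have inj_g : injective g.
  move=> s1 s2 eg; apply/val_inj/(@eq_from_nth _ ord0); first by rewrite !size_tuple.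
  move=> i; rewrite size_tuple => lt_ik.
  case eF : (enum F) szF => [|e0 F'] szF; first by rewrite -szF in lt_ik.
  rewrite -eF in szF; pose e := nth e0 (enum F) i.
  have eiF : e \in F by rewrite -mem_enum mem_nth ?szF.
  have := congr1 (fun f : {ffun X -> 'I_(k + N).+1} => f e : nat) eg.
  rewrite /= !gE eiF /e index_uniq ?enum_uniq ?szF // => -[] /val_inj //.
have sum_g (s : k.-tuple 'I_N.+1) : \sum_e (g s e : nat) = k + \sum_(i <- s) (i : nat).
  rewrite (eq_bigr _ (fun e _ => gE s e)) -big_mkcond /=.
  under eq_bigr do rewrite -add1n.
  rewrite big_split /= sum1_card; congr (_ + _).
  rewrite sumF; case eF : (enum F) szF => [|e0 F'] szF.
    rewrite big_nil; case: s => -[|x s] //= szs; first by rewrite big_nil.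
    by move: szs; rewrite -szF.
  rewrite -eF in szF *.
  rewrite (big_nth e0) (big_nth ord0) size_tuple szF; apply: eq_big_nat => i /andP[_ lt_ik].
  by rewrite index_uniq ?enum_uniq ?szF.
rewrite -(card_imset _ inj_g); apply: eq_card => m; rewrite !inE.
apply/andP/imsetP => [[/eqP supp_m le_m]|[s]]; last first.
  rewrite inE => le_s ->; rewrite sum_g leq_add2l le_s; split=> //.
  by apply/eqP/setP => e; rewrite inE gE; case: ifP.
have m0 e : (m e : nat) = if e \in F then ((m e).-1).+1 else 0.
  by rewrite -supp_m inE; case: (m e : nat).
have sum_m : \sum_e (m e : nat) = k + \sum_(e in F) (m e).-1.
  rewrite (eq_bigr _ (fun e _ => m0 e)) -big_mkcond /=.
  under eq_bigr do rewrite -add1n.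
  by rewrite big_split /= sum1_card.
have le_mN e : e \in F -> (m e).-1 < N.+1.
  move=> eF; rewrite ltnS; move: le_m; rewrite sum_m leq_add2l; apply: leq_trans.
  by rewrite (bigD1 e) //= leq_addr.
have szs : size [seq (inord (m e).-1 : 'I_N.+1) | e <- enum F] == k by rewrite size_map szF.
exists (Tuple szs).
  rewrite inE /= big_map -sumF (eq_bigr (fun e => (m e).-1)) => [|e eF]; last first.
    by rewrite inordK ?le_mN.
  by move: le_m; rewrite sum_m leq_add2l.
apply/ffunP => e; apply/val_inj; rewrite /= gE m0; case: ifP => // eF; congr _.+1.
rewrite (nth_map e) ?index_mem ?mem_enum // nth_index ?mem_enum //.
by rewrite inordK ?le_mN.
Qed.

End Counting.

Section FaceCount.

Variables (n : nat) (T : {set 'I_n.+1 * 'I_n.+1}).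
Hypothesis n_gt0 : 0 < n.
Hypothesis treeT : is_tree T.
Hypothesis ncT : noncrossing T.

Lemma sum_faces t :
  \sum_(F : {set 'I_n.+1 * 'I_n.+1} | `[< face T F >]) 'C(t, #|F|) =
  \sum_(M : {set 'I_n.+1 * 'I_n.+1} | `[< facet T M >]) 'C(t + (n - #|S_T T M|), n).
Proof.
transitivity (\sum_(F : {set 'I_n.+1 * 'I_n.+1} | `[< face T F >])
   \sum_(M : {set 'I_n.+1 * 'I_n.+1} | `[< facet T M >] && ((S_T T M \subset F) && (F \subset M)))
      'C(t, #|F|)).
  apply: eq_bigr => F /asboolP fF.
  have [M [fM sFM sSF] uniqM] := face_facet treeT ncT fF.
  rewrite (big_pred1 M) // => M'; apply/idP/eqP => [|->].
    by move=> /andP[/asboolP fM' /andP[sS sF]]; apply: uniqM.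
  by rewrite sFM sSF !andbT; apply/asboolP.
rewrite (exchange_big_dep (fun M => `[< facet T M >])) /=; last by move=> F M _ /andP[].
apply: eq_bigr => M fMb; have fM := asboolW fMb; have ltSM := S_T_proper treeT ncT n_gt0 fM.
have := sum_binomial_interval t (fintype.proper_sub ltSM).
rewrite (card_facet treeT ncT fM) => <-.
apply: eq_bigl => F; rewrite fMb /= andb_idl // => /andP[_ sFM].
apply/asboolP; have [ncM altM sM] := facet_face fM; have sub := fintype.subsetP sFM.
split; last exact: fintype.subset_trans sM.
  by move=> i j k l ? ? ? [/sub Fik /sub Fjl]; apply: (ncM i j k l).
by move=> i j k ? ? [/sub Fij /sub Fjk]; apply: (altM i j k).
Qed.

End FaceCount.

(** * Lattice points *)

Section LatticePoints.

Local Open Scope ring_scope.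

Variable n : nat.
Notation V := 'I_n.+1.
Implicit Types (m : V * V -> nat) (e : V * V) (G H F : {set V * V}).

Definition zroot e : 'rV[int]_n.+1 := delta_mx 0 e.1 - delta_mx 0 e.2.

Definition zvec m : 'rV[int]_n.+1 := \sum_e zroot e *+ m e.

Definition supp m : {set V * V} := [set e | (0 < m e)%N]%SET.

Lemma eq_zvec m1 m2 : m1 =1 m2 -> zvec m1 = zvec m2.
Proof. by move=> eq_m; apply: eq_bigr => e _; rewrite eq_m. Qed.

Lemma zvecD m1 m2 : zvec (fun e => m1 e + m2 e)%N = zvec m1 + zvec m2.
Proof. by rewrite -big_split; apply: eq_bigr => e _; rewrite mulrnDr. Qed.

Lemma zvec_delta e : zvec (fun x => x == e) = zroot e.
Proof.
rewrite /zvec (bigD1 e) //= eqxx mulr1n big1 ?addr0 // => x /negPf->.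
by rewrite mulr0n.
Qed.

Lemma zvecE m v : zvec m 0 v = (\sum_k m (v, k)%N)%N%:Z - (\sum_k m (k, v))%N%:Z.
Proof.
rewrite summxE (eq_bigr (fun e => (m e * (e.1 == v))%N%:Z - (m e * (e.2 == v))%N%:Z)); last first.
  move=> [i j] _; rewrite mulmxnE !mxE eqxx /= ![v == _]eq_sym.
  by case: (i == v); case: (j == v); rewrite /= ?muln0 ?muln1 ?mul0rn; lia.
rewrite sumrB -!(big_morph Posz PoszD (erefl 0%:Z)); congr (Posz _ - Posz _).
  rewrite (eq_bigr (fun e => m (e.1, e.2) * (e.1 == v))%N) => [|[] //].
  rewrite -(pair_bigA _ (fun i j => m (i, j) * (i == v))%N) /= (bigD1 v) //=.
  rewrite [X in (_ + X)%N]big1 ?addn0 => [|i /negPf->].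
    by apply: eq_bigr => k _; rewrite eqxx muln1.
  by apply: big1 => k _; rewrite muln0.
rewrite (eq_bigr (fun e => m (e.1, e.2) * (e.2 == v))%N) => [|[] //].
rewrite -(pair_bigA _ (fun i j => m (i, j) * (j == v))%N) /=.
apply: eq_bigr => i _; rewrite (bigD1 v) //= eqxx muln1 big1 ?addn0 // => k /negPf->.
by rewrite muln0.
Qed.

Definition nc_alt_graph G := [/\ is_graph G, noncrossing G & alternating G].

Lemma nc_alt_sub G H : H \subset G -> nc_alt_graph G -> nc_alt_graph H.
Proof.
move=> /fintype.subsetP sub [/is_graphP gG ncG altG]; split.
- by apply/is_graphP => i j /sub; apply: gG.
- by move=> i j k l ? ? ? [/sub Gik /sub Gjl]; apply: (ncG i j k l).
by move=> i j k ? ? [/sub Gij /sub Gjk]; apply: (altG i j k).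
Qed.

Lemma mem_supp m e : (e \in supp m) = (0 < m e)%N.
Proof. by rewrite inE. Qed.

(** In an alternating graph the edges at a vertex all leave it or all enter it, so no cancellation
    occurs and the sign of a coordinate tells left ends from right ends. *)
Lemma zvec_edge m i j : nc_alt_graph (supp m) -> (0 < m (i, j))%N ->
  0 < zvec m 0 i /\ zvec m 0 j < 0.
Proof.
move=> [/is_graphP gm _ altm] mij; have Gij : (i, j) \in supp m by rewrite mem_supp.
have no_path a b c : (0 < m (a, b))%N -> (0 < m (b, c))%N -> False.
  rewrite -!mem_supp => Gab Gbc.
  by apply: (altm a b c); rewrite ?gm.
rewrite !zvecE; split.
  rewrite [X in _ - Posz X]big1 => [|k _]; last first.
    by case mki: (m (k, i)) => //; case: (no_path k i j); rewrite ?mki.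
  by rewrite subr0 (bigD1 j) //= ltz_nat; lia.
rewrite big1 => [|k _]; last first.
  by case mjk: (m (j, k)) => //; case: (no_path i j k); rewrite ?mjk.
by rewrite sub0r oppr_lt0 (bigD1 i) //= ltz_nat; lia.
Qed.

Lemma zvec_pos m i : 0 < zvec m 0 i -> exists k, (0 < m (i, k))%N.
Proof.
rewrite zvecE => pos; apply: contrapT => none; move: pos.
rewrite big1 => [|k _]; first by rewrite sub0r oppr_gt0 ltNge.
by case mik: (m (i, k)) => //; case: none; exists k; rewrite mik.
Qed.

Lemma zvec_neg m j : zvec m 0 j < 0 -> exists k, (0 < m (k, j))%N.
Proof.
rewrite zvecE => neg; apply: contrapT => none; move: neg.
rewrite [X in _ - Posz X]big1 => [|k _]; first by rewrite subr0 ltNge.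
by case mkj: (m (k, j)) => //; case: none; exists k; rewrite mkj.
Qed.

(** The signs of the coordinates give [m2] an edge [(i, k)] and an edge [(l, j)]. Neither is shorter
    than [(i, j)], so [l <= i < j <= k]; unless one of them is [(i, j)], they cross. *)
Lemma shortest_edge_shared m1 m2 e : nc_alt_graph (supp m1) -> nc_alt_graph (supp m2) ->
  zvec m1 = zvec m2 -> (0 < m1 e)%N ->
  (forall f, (0 < m2 f)%N -> (e.2 - e.1 <= f.2 - f.1)%N) -> (0 < m2 e)%N.
Proof.
case: e => i j g1 g2 eqz mij shortest.
have [zi zj] := zvec_edge g1 mij; rewrite eqz in zi zj.
have [k mik] := zvec_pos zi; have [l mlj] := zvec_neg zj.
case: g2 => /is_graphP gr2 nc2 _; case: g1 => /is_graphP gr1 _ _.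
have lt_ij : (i < j)%N by apply: gr1; rewrite mem_supp.
have lt_ik : (i < k)%N by apply: gr2; rewrite mem_supp.
have lt_lj : (l < j)%N by apply: gr2; rewrite mem_supp.
have /= le_jk := shortest _ mik; have /= le_li := shortest _ mlj.
have [eq_kj|ne_kj] := eqVneq k j; first by rewrite -eq_kj.
have [eq_li|ne_li] := eqVneq l i; first by rewrite -eq_li.
have ne_kj' : k <> j :> nat by move/val_inj/eqP; apply/negP.
have ne_li' : l <> i :> nat by move/val_inj/eqP; apply/negP.
by case: (nc2 l i j k); rewrite ?mem_supp; try lia.
Qed.

Lemma common_edge m1 m2 e0 : nc_alt_graph (supp m1) -> nc_alt_graph (supp m2) ->
  zvec m1 = zvec m2 -> (0 < m1 e0 + m2 e0)%N ->
  exists2 e, (0 < m1 e)%N & (0 < m2 e)%N.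
Proof.
move=> g1 g2 eqz me0; pose P e := (0 < m1 e + m2 e)%N.
have Pe0 : P e0 by [].
case: (arg_minnP (fun e : V * V => e.2 - e.1)%N Pe0) => e Pe min_e; exists e.
  rewrite lt0n; apply/negP => /eqP m1e; suff : (0 < m1 e)%N by rewrite m1e.
  apply: (shortest_edge_shared g2 g1 (esym eqz)); first by move: Pe; rewrite /P m1e.
  by move=> f m1f; apply: min_e; rewrite /P; lia.
rewrite lt0n; apply/negP => /eqP m2e; suff : (0 < m2 e)%N by rewrite m2e.
apply: (shortest_edge_shared g1 g2 eqz); first by move: Pe; rewrite /P m2e addn0.
by move=> f m2f; apply: min_e; rewrite /P; lia.
Qed.

(** Induction on the total multiplicity of [m1], removing one copy of a common edge from both
    sides. *)
Lemma zvec_inj m1 m2 : nc_alt_graph (supp m1) -> nc_alt_graph (supp m2) ->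
  zvec m1 = zvec m2 -> m1 =1 m2.
Proof.
have [N] := ubnP (\sum_e m1 e)%N; elim: N => // N IHN in m1 m2 * => le_N g1 g2 eqz.
move=> e0; have [|me0] := posnP (m1 e0 + m2 e0); first by lia.
have [e m1e m2e] := common_edge g1 g2 eqz me0.
pose del m x := (m x - (x == e))%N.
have delK m : (0 < m e)%N -> m =1 (fun x => del m x + (x == e))%N.
  by move=> me x; rewrite /del; case: eqP => [->|] /=; lia.
have supp_del m : supp (del m) \subset supp m.
  by apply/fintype.subsetP => x; rewrite !mem_supp /del; lia.
have zdel m : (0 < m e)%N -> zvec (del m) = zvec m - zroot e.
  by move=> me; rewrite (eq_zvec (delK m me)) zvecD zvec_delta addrK.
have eq_del : del m1 =1 del m2.
  apply: IHN; last by rewrite !zdel // eqz.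
  - have : (\sum_x m1 x = \sum_x (del m1 x + (x == e)))%N.
      by apply: eq_bigr => x _; apply: delK.
    rewrite big_split /=.
    rewrite [X in (_ + X)%N](bigD1 e) //= eqxx addnCA add1n => eqs.
    by move: le_N; rewrite eqs ltnS; apply: leq_trans; rewrite ltnS leq_addr.
  - exact: nc_alt_sub g1.
  - exact: nc_alt_sub g2.
by rewrite (delK m1 m1e) (delK m2 m2e) eq_del.
Qed.

End LatticePoints.

(** * Straightening a combination of closure edges onto a face *)

Section NoncrossingDecomposition.

Local Open Scope ring_scope.

Variables (n : nat) (T : {set 'I_n.+1 * 'I_n.+1}).
Notation V := 'I_n.+1.
Hypothesis treeT : is_tree T.
Hypothesis ncT : noncrossing T.
Implicit Types (m : V * V -> nat) (e : V * V) (G H F : {set V * V}).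

Let graphT : is_graph T. Proof. by case: treeT => -[]. Qed.

Lemma face_nc_alt F : face T F -> nc_alt_graph F.
Proof. by move=> fF; have [ncF altF _] := fF; split=> //; apply: face_graph fF. Qed.

(** Both replacements preserve the total length and increase the total squared length. The term with
    [n.+1] is therefore constant, and makes the decreasing quantity a natural number. *)
Definition spread e := ((e.2 - e.1) * (n.+1 - (e.2 - e.1)))%N.

Definition total_spread m := (\sum_e m e * spread e)%N.

Lemma total_spreadD m1 m2 :
  total_spread (fun e => m1 e + m2 e)%N = (total_spread m1 + total_spread m2)%N.
Proof. by rewrite -big_split; apply: eq_bigr => e _; rewrite mulnDl. Qed.

Lemma total_spread_delta e : total_spread (fun x => x == e) = spread e.
Proof.
rewrite /total_spread (bigD1 e) //= eqxx mul1n big1 ?addn0 // => x /negPf->.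
by rewrite mul0n.
Qed.

Lemma split_two_edges m e1 e2 : e1 != e2 -> e1 \in supp m -> e2 \in supp m ->
  exists2 m0, m =1 (fun x => m0 x + ((x == e1) + (x == e2)))%N & supp m0 \subset supp m.
Proof.
rewrite !mem_supp => ne12 me1 me2; exists (fun x => m x - ((x == e1) + (x == e2)))%N.
  move=> x; case: eqP => [->|_]; first by rewrite (negPf ne12); lia.
  by case: eqP => [->|_]; lia.
by apply/fintype.subsetP => x; rewrite !mem_supp; lia.
Qed.

(* Uncrossing two edges, or replacing (i,j),(j,k) by (i,k), decreases the total spread,
   because spread is a strictly concave function of the length of an edge, null at 0. *)
Lemma face_decomposition m : supp m \subset transitive_closure T ->
  exists2 m', face T (supp m') & zvec m' = zvec m.
Proof.
have [N] := ubnP (total_spread m); elim: N => // N IHN in m * => le_N sm.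
have sub := fintype.subsetP sm.
have ltm i j : (i, j) \in supp m -> (i < j)%N.
  by move/sub/(transitive_closureP _ _ graphT) => [].
have Rm i j : (i, j) \in supp m -> reach (nat_edge T) i j.
  by move/sub/(transitive_closureP _ _ graphT) => [].
have meet_l := reach_meet_left (fun x y => @nat_edge_lt _ T x y graphT)
  (fun i j k l => @nat_edge_nc _ T i j k l ncT).
have meet_r := reach_meet_right (fun x y => @nat_edge_lt _ T x y graphT)
  (fun i j k l => @nat_edge_nc _ T i j k l ncT).
have in_closure (i j : V) : (i < j)%N -> reach (nat_edge T) i j -> (i, j) \in transitive_closure T.
  by move=> lt_ij Rij; apply/(transitive_closureP _ _ graphT).
have spread_ltn (i j : V) : (i < j)%N -> (j <= n)%N by have := ltn_ord j; lia.
have [ncm|nncm] := pselect (noncrossing (supp m)); last first.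
  move/existsNP: nncm => [i /existsNP[j /existsNP[k /existsNP[l]]]].
  move=> /not_implyP[lt_ij /not_implyP[lt_jk /not_implyP[lt_kl /contrapT[mik mjl]]]].
  have ne : (i, k) != (j, l) by apply/eqP => -[eij _]; rewrite eij ltnn in lt_ij.
  have [m0 em sm0] := split_two_edges ne mik mjl.
  pose m1 x := (m0 x + ((x == (i, l)) + (x == (j, k))))%N.
  have lt_ik := ltn_trans lt_ij lt_jk; have lt_jl := ltn_trans lt_jk lt_kl.
  have Cil : (i, l) \in transitive_closure T.
    apply: in_closure; first exact: ltn_trans lt_kl.
    by apply: (meet_l _ _ _ _ (Rm _ _ mik) (Rm _ _ mjl)); apply: ltnW.
  have Cjk : (j, k) \in transitive_closure T.
    apply: in_closure => //.
    by apply: (meet_r _ _ _ _ (Rm _ _ mik) (Rm _ _ mjl)); apply: ltnW.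
  have ez : zvec m1 = zvec m.
    rewrite (eq_zvec em) !zvecD !zvec_delta; congr (_ + _).
    by rewrite /zroot /= addrACA [RHS]addrACA [in RHS](addrC (- _)).
  rewrite -ez; apply: IHN.
    suff : (total_spread m1 < total_spread m)%N by lia.
    have -> : total_spread m = total_spread (fun x => m0 x + ((x == (i, k)) + (x == (j, l))))%N.
      by apply: eq_bigr => x _; rewrite em.
    rewrite !total_spreadD !total_spread_delta ltn_add2l /spread /=.
    have := ltn_ord l; nia.
  apply/fintype.subsetP => x; rewrite mem_supp /m1.
  have [->//|_] := eqVneq x (i, l); have [->//|_] := eqVneq x (j, k).
  by rewrite addn0 => m0x; apply/sub/(fintype.subsetP sm0); rewrite mem_supp.
have [altm|naltm] := pselect (alternating (supp m)); last first.
  move/existsNP: naltm => [i /existsNP[j /existsNP[k]]].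
  move=> /not_implyP[lt_ij /not_implyP[lt_jk /contrapT[mij mjk]]].
  have ne : (i, j) != (j, k) by apply/eqP => -[eij _]; rewrite eij ltnn in lt_ij.
  have [m0 em sm0] := split_two_edges ne mij mjk.
  pose m1 x := (m0 x + (x == (i, k)))%N.
  have Cik : (i, k) \in transitive_closure T.
    apply: in_closure; first exact: ltn_trans lt_jk.
    exact: reach_trans (Rm _ _ mij) (Rm _ _ mjk).
  have ez : zvec m1 = zvec m.
    rewrite (eq_zvec em) !zvecD !zvec_delta; congr (_ + _).
    by rewrite /zroot /= addrA subrK.
  rewrite -ez; apply: IHN.
    suff : (total_spread m1 < total_spread m)%N by lia.
    have -> : total_spread m = total_spread (fun x => m0 x + ((x == (i, j)) + (x == (j, k))))%N.
      by apply: eq_bigr => x _; rewrite em.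
    rewrite !total_spreadD !total_spread_delta ltn_add2l /spread /=.
    have := ltn_ord k; nia.
  apply/fintype.subsetP => x; rewrite mem_supp /m1.
  have [->//|_] := eqVneq x (i, k).
  by rewrite addn0 => m0x; apply/sub/(fintype.subsetP sm0); rewrite mem_supp.
by exists m.
Qed.

End NoncrossingDecomposition.

(** * Lattice points of the dilated root polytope *)

Section PolytopePoints.

Local Open Scope ring_scope.

Variables (R : realType) (n : nat).
Notation V := 'I_n.+1.
Implicit Types (m : V * V -> nat) (e : V * V) (G T : {set V * V}).

Lemma map_zvec m : map_mx intr (zvec m) = \sum_e (m e)%:R *: root_vector R e.
Proof.
apply/rowP => v; rewrite mxE !summxE rmorph_sum; apply: eq_bigr => e _ /=.
rewrite mulmxnE !mxE rmorphMn rmorphB /= mulr_natl; congr (_ *+ _).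
by do 2 case: (_ == _).
Qed.

Lemma sum_coord_comb (I : finType) (P : pred I) (A : pred V) (a : I -> R) (x : I -> 'rV[R]_n.+1) :
  \sum_(v in A) (\sum_(s | P s) a s *: x s) 0 v = \sum_(s | P s) a s * \sum_(v in A) x s 0 v.
Proof.
under eq_bigr do rewrite summxE; rewrite exchange_big; apply: eq_bigr => s _ /=.
by rewrite mulr_sumr; apply: eq_bigr => v _; rewrite mxE.
Qed.

Lemma sum_coord_root (A : pred V) e :
  \sum_(v in A) root_vector R e 0 v = (e.1 \in A)%:R - (e.2 \in A)%:R.
Proof.
have delta i : \sum_(v in A) (delta_mx 0 i : 'rV[R]_n.+1) 0 v = (i \in A)%:R.
  rewrite big_mkcond (bigD1 i) //= big1 ?addr0 => [|v ne_vi].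
    by rewrite mxE !eqxx; case: ifP.
  by rewrite mxE (negPf ne_vi) andbF if_same.
by rewrite -!delta -sumrB; apply: eq_bigr => v _; rewrite !mxE.
Qed.

(** Deleting [e] cuts the tree in two. Summing the coordinates over the component [A] of [e.1] kills
    every other edge and leaves [a e] on one side, an integer on the other. *)
Lemma tree_cone_int T (a : V * V -> R) (z : 'rV[int]_n.+1) e : is_tree T ->
  map_mx intr z = \sum_(p in T) a p *: root_vector R p -> e \in T ->
  exists k : int, a e = k%:~R.
Proof.
case=> -[gT acT] _ ez Te; pose A : pred V := fun i => connect (adj (T :\ e)) e.1 i.
have inA i : (i \in A) = connect (adj (T :\ e)) e.1 i by [].
have := congr1 (fun v : 'rV[R]_n.+1 => \sum_(i in A) v 0 i) ez.
rewrite sum_coord_comb (bigD1 e) //= sum_coord_root.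
have -> : e.1 \in A by rewrite inA connect0.
have /negPf -> : e.2 \notin A by rewrite inA acyclic_bridge.
rewrite [X in _ + X]big1 => [|p /andP[Tp ne_pe]]; last first.
  have Ap : adj (T :\ e) p.1 p.2 by rewrite /adj !inE -surjective_pairing ne_pe Tp.
  rewrite sum_coord_root; have -> : (p.1 \in A) = (p.2 \in A).
    rewrite !inA; apply/idP/idP => /connect_trans; apply; apply: connect1 => //.
    by rewrite adj_sym.
  by rewrite subrr mulr0.
rewrite subr0 mulr1 addr0 => <-; exists (\sum_(i in A) z 0 i).
by rewrite rmorph_sum; apply: eq_bigr => i _; rewrite mxE.
Qed.

Lemma root_cone_add G u v : root_cone R G u -> root_cone R G v -> root_cone R G (u + v).
Proof.
move=> [a a0 ->] [b b0 ->]; exists (fun e => a e + b e).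
  by move=> e Ge; rewrite addr_ge0 ?a0 ?b0.
by rewrite -big_split; apply: eq_bigr => e _; rewrite scalerDl.
Qed.

Lemma root_cone_scale G (c : R) u : 0 <= c -> root_cone R G u -> root_cone R G (c *: u).
Proof.
move=> c0 [a a0 ->]; exists (fun e => c * a e).
  by move=> e Ge; rewrite mulr_ge0 ?a0.
by rewrite scaler_sumr; apply: eq_bigr => e _; rewrite scalerA.
Qed.

Lemma root_cone0 G : root_cone R G 0.
Proof. by exists (fun=> 0) => //; rewrite big1 // => e _; rewrite scale0r. Qed.

Lemma root_cone_edge G e : e \in G -> root_cone R G (root_vector R e).
Proof.
move=> Ge; exists (fun f => (f == e)%:R); first by move=> f _; apply: ler0n.
rewrite (bigD1 e) //= eqxx scale1r big1 ?addr0 // => f /andP[_ /negPf->].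
by rewrite scale0r.
Qed.

Lemma root_cone_closure T e : is_graph T -> e \in transitive_closure T ->
  root_cone R T (root_vector R e).
Proof.
case: e => i j gT /(transitive_closureP _ _ gT)[_ Rij].
suff cone x y : reach (nat_edge T) x y -> forall i j : V, x = i -> y = j ->
    root_cone R T (root_vector R (i, j)) by exact: cone Rij _ _ erefl erefl.
elim=> [z i' j' -> /val_inj ->|a b c [i1 [k [Tik -> ->]]] _ IH i' j' /val_inj<- ej].
  by rewrite /root_vector subrr; apply: root_cone0.
have -> : root_vector R (i1, j') = root_vector R (i1, k) + root_vector R (k, j').
  by rewrite /root_vector /= addrA subrK.
by apply: root_cone_add; [apply: root_cone_edge | apply: IH].
Qed.

Lemma root_cone_zvec T m : is_graph T -> supp m \subset transitive_closure T ->
  root_cone R T (map_mx intr (zvec m)).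
Proof.
move=> gT /fintype.subsetP sm; rewrite map_zvec; apply: big_ind.
- exact: root_cone0.
- exact: root_cone_add.
move=> e _; have [->|me] := posnP (m e); first by rewrite scale0r; apply: root_cone0.
apply: root_cone_scale; first exact: ler0n.
by apply: root_cone_closure => //; apply: sm; rewrite mem_supp.
Qed.

Lemma root_cone_int T z : is_tree T -> root_cone R T (map_mx intr z) ->
  exists2 m, supp m \subset T & z = zvec m.
Proof.
move=> treeT [a a0 ez].
have inta e : e \in T -> exists k : nat, a e = k%:R.
  move=> Te; have [k ak] := tree_cone_int treeT ez Te.
  have := a0 e Te; rewrite ak ler0z; case: k ak => // k ak _.
  by exists k.
pose m e := if e \in T then Num.truncn (a e) else 0%N.
exists m.
  by apply/fintype.subsetP => e; rewrite mem_supp /m; case: ifP.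
have inj : injective (map_mx intr : 'rV[int]_n.+1 -> 'rV[R]_n.+1).
  move=> u v /matrixP euv; apply/matrixP => i j; have := euv i j; rewrite !mxE.
  exact: intr_inj.
apply: inj; rewrite ez map_zvec big_mkcond; apply: eq_bigr => e _ /=.
rewrite /m; case: ifP => [/inta[k ->]|]; last by rewrite scale0r.
by rewrite natrK.
Qed.

(** Used with [A] the set of left ends of an alternating graph, where the sum is the height. *)
Lemma full_root_polytope_sum (A : pred V) v : full_root_polytope R n v ->
  \sum_(i in A) v 0 i <= 1.
Proof.
move=> [k [a [x [a0 suma xA ->]]]]; rewrite sum_coord_comb -suma.
apply: ler_sum => s _; rewrite -[leRHS]mulr1; apply: ler_wpM2l => //.
case: (xA s) => [->|[e _ <-]].
  by rewrite big1 // => i _; rewrite mxE.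
rewrite sum_coord_root lerBlDr (le_trans _ (_ : 1 <= _)) //.
  by rewrite lern1 leq_b1.
by rewrite lerDl ler0n.
Qed.

Lemma full_root_polytope_comb (a : V * V -> R) : (forall e, 0 <= a e) ->
  \sum_e a e <= 1 -> (forall e, ~~ (e.1 < e.2)%N -> a e = 0) ->
  full_root_polytope R n (\sum_e a e *: root_vector R e).
Proof.
move=> a0 suma agraph.
(* The weight missing to 1 is put on the diagonal pair [(ord0, ord0)], to which [x] assigns the
   origin. *)
pose b e := a e + (e == (ord0, ord0))%:R * (1 - \sum_f a f).
pose x e := if (e.1 < e.2)%N then root_vector R e else 0.
exists #|{: V * V}|, (fun s => b (enum_val s)), (fun s => x (enum_val s)).
have reidx (U : nmodType) (F : V * V -> U) : \sum_(s < #|{: V * V}|) F (enum_val s) = \sum_e F e.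
  rewrite [RHS](reindex (fun s : 'I_#|{: V * V}| => enum_val s)) //.
  exact/onW_bij/enum_val_bij.
split.
- by move=> s; rewrite addr_ge0 ?mulr_ge0 ?subr_ge0 ?ler0n.
- rewrite (reidx _ b) big_split /= -mulr_suml.
  rewrite [X in _ + X * _](bigD1 (ord0, ord0)) //= [X in _ + (_ + X) * _]big1 => [|e /negPf-> //].
  by rewrite ?eqxx addr0 mul1r addrC subrK.
- by move=> s; rewrite /x; case: ifP => [lt_e|_]; [right; exists (enum_val s) | left].
rewrite (reidx _ (fun e => b e *: x e)); apply: eq_bigr => e _.
rewrite /x /b; case: ifPn => [lt_e|/agraph ->]; last by rewrite scaler0 scale0r.
by case: eqP lt_e => [->|]; rewrite ?ltnn // mul0r addr0.
Qed.

Lemma dilate_root_polytope T t z : (0 < t)%N -> is_tree T -> noncrossing T ->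
  dilate t (root_polytope R T) (map_mx intr z) <->
  exists m, [/\ face T (supp m), (\sum_e m e <= t)%N & z = zvec m].
Proof.
move=> t_gt0 treeT ncT; have gT : is_graph T by case: treeT => -[].
have t0 : 0 < t%:R :> R by rewrite ltr0n.
split=> [[v [fv cv] ez]|[m [fm le_m ->]]].
  have [m0 sm0 ez0] : exists2 m, supp m \subset T & z = zvec m.
    by apply: root_cone_int => //; rewrite -ez; apply: root_cone_scale => //; apply: ltW.
  have sT : T \subset transitive_closure T.
    apply/fintype.subsetP => -[i j] Tij; apply/(transitive_closureP _ _ gT).
    by split; [apply: (is_graphP _ gT) | apply/reach1/nat_edgeP].
  have [m fm em] := face_decomposition treeT ncT (fintype.subset_trans sm0 sT).
  exists m; split; rewrite ?em //.
  (* On the left ends of the support each edge contributes exactly 1, by alternation, so the sum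
     over [A] is the total multiplicity. *)
  pose A : pred V := fun i => [exists j, (i, j) \in supp m].
  have : \sum_(i in A) (map_mx intr (zvec m) : 'rV[R]_n.+1) 0 i <= t%:R.
    rewrite em -ez0 -ez; under eq_bigr do rewrite mxE.
    by rewrite -mulr_sumr -[leRHS]mulr1 ler_pM2l // full_root_polytope_sum.
  rewrite map_zvec sum_coord_comb.
  rewrite (eq_bigr (fun e => (m e)%:R)) => [|e _]; first by rewrite -natr_sum ler_nat.
  rewrite sum_coord_root; have [->|me] := posnP (m e); first by rewrite mul0r.
  have [gm _ altm] := face_nc_alt treeT fm.
  have A1 : e.1 \in A.
    by rewrite unfold_in; apply/existsP; exists e.2; rewrite -surjective_pairing mem_supp.
  have /negPf -> : e.2 \notin A.
    rewrite unfold_in; apply/existsP => -[k mjk].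
    have mij : (e.1, e.2) \in supp m by rewrite -surjective_pairing mem_supp.
    by apply: (altm e.1 e.2 k); rewrite ?(is_graphP _ gm).
  by rewrite A1 subr0 mulr1.
have [_ _ sm] := fm; exists (t%:R^-1 *: map_mx intr (zvec m)); last first.
  by rewrite scalerA divff ?scale1r // gt_eqF.
split; last first.
  apply: root_cone_scale; first by rewrite invr_ge0 ltW.
  exact: root_cone_zvec.
rewrite map_zvec scaler_sumr; under eq_bigr do rewrite scalerA.
apply: full_root_polytope_comb.
- by move=> e; rewrite mulr_ge0 ?invr_ge0 ?ler0n.
- by rewrite -mulr_sumr -natr_sum ler_pdivrMl // mulr1 ler_nat.
move=> e; apply: contraNeq; rewrite mulf_eq0 negb_or pnatr_eq0 -lt0n -mem_supp => /andP[_ me].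
by have [gm _ _] := face_nc_alt treeT fm; apply: (is_graphP _ gm); rewrite -surjective_pairing.
Qed.

Lemma ehrhart_faces T t : (0 < t)%N -> is_tree T -> noncrossing T ->
  ehrhart (root_polytope R T) t = (\sum_(F : {set V * V} | `[< face T F >]) 'C(t, #|F|))%N.
Proof.
move=> t_gt0 treeT ncT; rewrite /ehrhart.
(* Multiplicities with sum at most [t] are themselves at most [t], so the lattice points are the
   image of a finite set; this also keeps [fset_set] away from its default value. *)
pose X := [set m : {ffun V * V -> 'I_t.+1} |
  `[< face T (supp (fun e => m e : nat)) >] && (\sum_e (m e : nat) <= t)%N]%SET.
pose psi (m : {ffun V * V -> 'I_t.+1}) := zvec (fun e => m e : nat).
have psi_inj : {in X &, injective psi}.
  move=> m1 m2; rewrite !inE => /andP[/asboolP f1 _] /andP[/asboolP f2 _] eq_psi.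
  apply/ffunP => e; apply/val_inj.
  exact: (zvec_inj (face_nc_alt treeT f1) (face_nc_alt treeT f2) eq_psi).
have -> : [set z : 'rV[int]_n.+1 | dilate t (root_polytope R T) (map_mx intr z)]%classic =
    [set` [fset psi m | m in X]%fset]%classic.
  apply/seteqP; split=> z /=.
    move=> /(dilate_root_polytope _ t_gt0 treeT ncT)[m [fm le_m ->]].
    have lt_m e : (m e < t.+1)%N.
      by rewrite ltnS (leq_trans _ le_m) // (bigD1 e) //= leq_addr.
    pose m' : {ffun V * V -> 'I_t.+1} := [ffun e => Ordinal (lt_m e)].
    have em' : (fun e => m' e : nat) = m by apply/funext => e; rewrite ffunE.
    apply/imfsetP; exists m' => /=; last by rewrite /psi em'.
    rewrite inE em'; apply/andP; split; first exact/asboolP.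
    by rewrite (eq_bigr m) // => e _; rewrite ffunE.
  move=> /imfsetP[m /=]; rewrite inE => /andP[/asboolP fm le_m] ->.
  by apply/dilate_root_polytope => //; exists (fun e => m e : nat).
rewrite set_fsetK card_in_imfset //= -cardE.
transitivity (\sum_(F : {set V * V} | `[< face T F >])
    #|[set m in X | supp (fun e => m e : nat) == F]%SET|)%N.
  rewrite -[LHS]sum1_card.
  rewrite (partition_big (fun m : {ffun V * V -> 'I_t.+1} => supp (fun e => m e : nat))
    (fun F => `[< face T F >])) /=.
    by apply: eq_bigr => F _; rewrite -sum1_card; apply: eq_bigl => m; rewrite !inE.
  by move=> m; rewrite inE => /andP[].
apply: eq_bigr => F fF; rewrite -card_ffun_support; apply: eq_card => m; rewrite !inE.
rewrite andbC -/(supp _); case: eqP => [->|] //=.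
by rewrite fF.
Qed.

End PolytopePoints.

(** * Generating series of shifted binomial coefficients *)

Section PowerSeries.

Local Open Scope ring_scope.

(** Moves a factor 1 - X from the polynomial to the series, where it acts as the backward
    difference. *)
Lemma fps_mul_1subX (p : {poly int}) (g : fps) :
  fps_mul (fps_of_poly (p * (1 - 'X))) g
  =1 fps_mul (fps_of_poly p) (fun j => g j - (if j is j'.+1 then g j' else 0)).
Proof.
move=> k; rewrite /fps_mul /fps_of_poly.
under eq_bigr => i _ do rewrite mulrBr mulr1 coefB coefMX mulrBl.
under [RHS]eq_bigr => i _ do rewrite mulrBr.
rewrite !sumrB; congr (_ - _).
rewrite big_ord_recl /= mul0r add0r [RHS]big_ord_recr /= subnn mulr0 addr0.
apply: eq_bigr => i _; rewrite /bump /= add1n.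
by have -> : (k - i = (k - i.+1).+1)%N by have := ltn_ord i; lia.
Qed.

Lemma eq_fps_mul (f g h : fps) : g =1 h -> fps_mul f g =1 fps_mul f h.
Proof. by move=> eq_gh k; apply: eq_bigr => i _; rewrite eq_gh. Qed.

(** The product is the monomial with exponent [n - d]. By Pascal's rule a backward difference lowers
    both [n] and [d] by one; when [d] is 0 it lowers [n] and shifts the series by one place
    instead. *)
Lemma fps_mul_binomial n d k : (d <= n)%N ->
  fps_mul (fps_of_poly ((1 - 'X) ^+ n.+1)) (fun j => ('C(j + d, n))%:R) k = (k + d == n)%N%:R.
Proof.
elim: n d k => [|n IHn] d k le_dn.
  have -> : d = 0%N by lia.
  rewrite expr1 -[1 - 'X]mul1r fps_mul_1subX /fps_mul /fps_of_poly.
  rewrite big_ord_recl coef1 mul1r subn0 big1 ?addr0 => [|i _]; last by rewrite coef1 mul0r.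
  by case: k => [|k]; rewrite !addn0 !bin0 ?subrr ?subr0.
rewrite exprSr fps_mul_1subX; case: d le_dn => [_|d le_dn].
  case: k => [|k].
    by rewrite /fps_mul big_ord1 subn0 addn0 bin0n /= subr0 mulr0.
  transitivity
    (fps_mul (fps_of_poly ((1 - 'X) ^+ n.+1)) (fun j => ('C(j + 0, n))%:R) k); last first.
    by rewrite IHn.
  rewrite /fps_mul big_ord_recr /= subnn addn0 bin0n subr0 mulr0 addr0.
  apply: eq_bigr => i _; have -> : (k.+1 - i = (k - i).+1)%N by have := ltn_ord i; lia.
  by rewrite !addn0 binS natrD addrAC subrr add0r.
rewrite -(@eq_fps_mul _ (fun j => ('C(j + d, n))%:R)) => [|j].
  by rewrite IHn ?addnS ?eqSS.
case: j => [|j]; last by rewrite addnS addSn addnS binS natrD addrAC subrr add0r.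
rewrite !add0n subr0; move: le_dn; rewrite ltnS leq_eqVlt => /orP[/eqP->|lt_dn].
  by rewrite !binn.
by rewrite !bin_small.
Qed.

End PowerSeries.

Local Open Scope ring_scope.

Theorem theorem29 (R : realType) (n : nat) (hn : (1 <= n)%N)
    (T : {set 'I_n.+1 * 'I_n.+1}) (lab : 'I_n.+1 * 'I_n.+1 -> nat)
    (hT : good_tree T lab) :
  fps_mul (fps_of_poly ((1 - 'X) ^+ n.+1))
          (ehrhart_series (root_polytope R T))
  =1 fps_of_poly (\sum_(1 <= l < n.+1) (c_count T (l - 1))%:R *: 'X^(l - 1)).
Proof.
case: hT => -[_ _ _ ncT] treeT k.
(* At t = 0 only the empty face counts, which agrees with the constant term 1 of J; the formula by
   faces thus covers all t. *)
have faces0 : (\sum_(F : {set 'I_n.+1 * 'I_n.+1} | `[< face T F >]) 'C(0, #|F|) = 1)%N.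
  rewrite (bigD1 finset.set0) /=; last first.
    by apply/asboolP; split; rewrite ?finset.sub0set // => i j *; rewrite !inE => -[].
  by rewrite cards0 big1 // => F /andP[_ F0]; rewrite bin_small // card_gt0.
have seriesE t : ehrhart_series (root_polytope R T) t =
    \sum_(M : {set 'I_n.+1 * 'I_n.+1} | `[< facet T M >]) ('C(t + (n - #|S_T T M|), n))%:R.
  rewrite -natr_sum -sum_faces // /ehrhart_series.
  by case: posnP => [->|t_gt0]; [rewrite faces0 | rewrite ehrhart_faces].
rewrite (eq_fps_mul _ seriesE) /fps_mul.
under eq_bigr do rewrite mulr_sumr.
rewrite exchange_big /=.
rewrite (eq_bigr (fun M => (#|S_T T M| == k)%:R)) => [|M /asboolP fM]; last first.
  have ltS := proper_card (S_T_proper treeT ncT hn fM).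
  rewrite (card_facet treeT ncT fM) in ltS.
  rewrite -[LHS]/(fps_mul _ (fun j => ('C(j + (n - #|S_T T M|), n))%:R) k).
  rewrite fps_mul_binomial ?leq_subr //; congr (nat_of_bool _)%:R.
  by apply/eqP/eqP; move: ltS; set r := #|_|; lia.
rewrite -natr_sum /fps_of_poly big_add1 /= big_mkord coef_sum.
under [RHS]eq_bigr => i _ do rewrite coefZ coefXn subn1 /= -natrM.
rewrite -natr_sum; congr (_%:R).
have cE l : (\sum_(M : {set 'I_n.+1 * 'I_n.+1} | `[< facet T M >]) (#|S_T T M| == l))%N =
    c_count T l.
  rewrite -big_mkcondr /= sum1dep_card; apply: eq_card => M; rewrite !inE.
  apply/andP/asboolP => [[/asboolP[? ? ?] /eqP ?] //|[? ? ? ?]].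
  by split; [apply/asboolP | apply/eqP].
(* Both sides vanish for [k >= n]: the left one because [S_T] has fewer than [n] elements, the right
   one because its exponents are below [n]. *)
have [lt_kn|le_nk] := ltnP k n; last first.
  rewrite !big1 // => [i _|M /asboolP fM].
    by case: eqP => [eq_ki|_]; [have := ltn_ord i; lia | rewrite muln0].
  have ltS := proper_card (S_T_proper treeT ncT hn fM).
  by rewrite (card_facet treeT ncT fM) in ltS; case: eqP ltS => // ->; rewrite ltnNge le_nk.
rewrite cE (bigD1 (Ordinal lt_kn)) //= eqxx muln1 big1 ?addn0 // => i ne_ik.
by case: eqP => [eq_ki|_]; rewrite ?muln0 //; case/eqP: ne_ik; apply/val_inj.
Qed.
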